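(* Let $D\subset\mathbb{R}^n$ be a domain and let $\phi$ be a norming function on $D$. Then the set $$SH^-_1(D,\phi)=\{u\in SH^-(D):\ \|u\|_\phi\le 1\}$$ is compact in $L^1(D,\phi)$.
   Context: A domain is a nonempty connected open set. For a positive continuous function $\phi$ on $D$, $L^1(D,\phi)$ is the Banach space of Lebesgue measurable functions $u$ on $D$ (modulo equality a.e.) with $\|u\|_\phi=\int_D|u|\,\phi\,dx<\infty$; for a measurable set $E\subset D$, put $\|u\|_{L^1(E,\phi)}=\int_E|u|\,\phi\,dx$. ''Negative'' means $\le 0$, and negative subharmonic functions are assumed not to be identically $-\infty$. $SH^-(D)$ denotes the cone of all non-positive subharmonic functions on $D$. The notation $A\Subset D$ means that $A$ is relatively compact in $D$. A positive continuous function $\phi$ on $D$ is called norming if for each compact set $F\subset D$ there is a constant $C(F)>0$, and for every increasing sequence of subdomains $D_j\Subset D$ with $\bigcup_j D_j=D$ there is a sequence of numbers $\varepsilon_j>0$ converging to $0$, such that for every negative subharmonic function $u$ on $D$: (1) $\|u\|_\phi<\infty$; (2) $u(x)\le -C(F)\|u\|_\phi$ for every $x\in F$; (3) $\|u\|_{L^1(D\setminus D_j,\phi)}\le\varepsilon_j\|u\|_\phi$ for every $j$. (The constants $C(F)$ and $\varepsilon_j$ do not depend on $u$.) *)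

(* Defs.v *)
From HB Require Import structures.
From mathcomp Require Import all_boot all_order all_algebra.
From mathcomp Require Import all_classical all_reals all_analysis.
From mathcomp Require Import measurable_realfun.

Set Implicit Arguments.
Unset Strict Implicit.
Unset Printing Implicit Defensive.

Import Order.TTheory GRing.Theory Num.Theory.
Import numFieldNormedType.Exports.

Local Open Scope classical_set_scope.
Local Open Scope ring_scope.

Definition measure_rV_display : measure_display.
Proof. exact: default_measure_display. Qed.

(* 'rV[R]_n carries the sigma-algebra generated by the coordinates, as n.-tuple
   does; it is the Borel sigma-algebra by measurable_rVE. *)
Section rV_measurable.
Context {R : realType} {n : nat}.

Definition rV_coord (i : 'I_n) (x : 'rV[R]_n) : R := x ord0 i.

Let rV_set0 : g_sigma_preimage rV_coord set0.
Proof. exact: sigma_algebra0. Qed.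

Let rV_setC A : g_sigma_preimage rV_coord A -> g_sigma_preimage rV_coord (~` A).
Proof. exact: sigma_algebraC. Qed.

Let rV_bigcup (F : _^nat) : (forall i, g_sigma_preimage rV_coord (F i)) ->
  g_sigma_preimage rV_coord (\bigcup_i (F i)).
Proof. exact: sigma_algebra_bigcup. Qed.

HB.instance Definition _ := @isMeasurable.Build measure_rV_display
  'rV[R]_n (g_sigma_preimage rV_coord) rV_set0 rV_setC rV_bigcup.

Lemma measurable_rV_coord (i : 'I_n) : measurable_fun setT (rV_coord i).
Proof.
move=> _ Y mY; rewrite setTI; apply: sub_sigma_algebra => /=.
rewrite -bigcup_seq/=; exists i => /=; first by rewrite mem_index_enum.
by exists Y => //; rewrite setTI.
Qed.

Lemma measurable_fun_rV d (T : measurableType d) (f : T -> 'rV[R]_n) :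
  (forall i, measurable_fun setT (rV_coord i \o f)) -> measurable_fun setT f.
Proof.
move=> mf; move=> _ A mA; rewrite setTI.
pose G : set_system 'rV[R]_n := [set A | measurable (f @^-1` A)].
suff : @measurable _ 'rV[R]_n `<=` G by exact.
apply: smallest_sub.
  split; rewrite /G/=.
  - by rewrite preimage_set0.
  - by move=> B mB; rewrite setTD -preimage_setC; exact: measurableC.
  - by move=> B mB; rewrite preimage_bigcup; exact: bigcupT_measurable.
move=> B; rewrite -bigcup_seq/= => -[i _ [C mC <-]].
rewrite /G/= setTI -comp_preimage -[X in measurable X]setTI.
exact: mf.
Qed.

Lemma measurable_rV_ball (x : 'rV[R]_n) (e : R) : measurable (ball x e).
Proof.
have [e0|e0] := ltP 0 e; last first.
  rewrite (_ : ball x e = set0)//; apply/seteqP; split => // y.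
  by move=> [/lt_le_trans/(_ e0)]; rewrite ltxx.
rewrite (_ : ball x e =
    \bigcap_(i in [set: 'I_n]) (rV_coord i @^-1` ball (x ord0 i) e)); last first.
  apply/seteqP; split => y /=; first by move=> [_ h] i _; exact: h.
  by move=> h; split => // i j; rewrite (ord1 i); exact: h.
apply: fin_bigcap_measurable => [|i _]; first exact: finite_finset.
rewrite -[X in measurable X]setTI; apply: measurable_rV_coord => //.
exact: measurable_ball.
Qed.

Lemma open_measurable_rV (U : set 'rV[R]_n) : open U -> measurable U.
Proof.
move=> oU.
pose B (p : 'rV[rat]_n * nat) : set 'rV[R]_n :=
  ball (map_mx ratr p.1 : 'rV[R]_n) p.2.+1%:R^-1.
rewrite (_ : U = \bigcup_(p in [set p | B p `<=` U]) B p); last first.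
  apply/seteqP; split => [x Ux|x [p /= pU]]; last exact: pU.
  have /nbhs_ballP[e /= e0 xeU] : nbhs x U by exact: open_nbhs_nbhs.
  have [k] := ltr_add_invr (divr_gt0 e0 (ltr0Sn R 1)).
  rewrite add0r => ke; have k0 : 0 < k.+1%:R^-1 :> R by rewrite invr_gt0.
  have /choice[q hq] : forall j : 'I_n, exists q : rat,
      ball (x ord0 j) k.+1%:R^-1 (ratr q).
    move=> j; have /rat_in_itvoo[q hq] :
        x ord0 j - k.+1%:R^-1 < x ord0 j + k.+1%:R^-1 by rewrite ltrD2l gtrN.
    exists q; rewrite /ball/= ltr_distlC.
    by move: hq; rewrite in_itv/= => /andP[-> ->].
  exists (\row_j q j, k) => /=.
    move=> y [_ By]; apply: xeU; split => // i j.
    rewrite (ord1 i) [e]splitr.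
    have qy : ball (ratr (q j) : R) (e / 2) (y ord0 j).
      by have := By ord0 j; rewrite !mxE; apply: le_ball; exact: ltW.
    by apply: ball_triangle qy; apply: le_ball (hq j); exact: ltW.
  split => // i j; rewrite (ord1 i) !mxE; exact: ball_sym.
rewrite bigcup_mkcond; apply: countable_bigcupT_measurable => // p.
by case: ifPn => // _; exact: measurable_rV_ball.
Qed.

Lemma measurable_rVE : @measurable _ 'rV[R]_n = <<s @open 'rV[R]_n >>.
Proof.
apply/seteqP; split; last first.
  apply: smallest_sub; first exact: sigma_algebra_measurable.
  by move=> U; exact: open_measurable_rV.
apply: smallest_sub; first exact: smallest_sigma_algebra.
move=> B; rewrite -bigcup_seq/= => -[i _ [C mC <-]].
suff : @measurable_fun _ _ (g_sigma_algebraType (@open 'rV[R]_n)) R setT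
  (rV_coord i) by move=> /(_ measurableT _ mC).
apply: (measurability _ (RGenOpens.measurableE R)).
move=> _ [_ [a [b ->] <-]]; rewrite setTI; apply: sub_sigma_algebra.
apply: (@open_comp 'rV[R]_n R); last exact: interval_open.
by move=> x _; exact: coord_continuous.
Qed.

End rV_measurable.

(* Lebesgue measure on R^n as the n-fold product of lebesgue_measure; its value
   on boxes is given by lebesgue_rV_box. *)
Section rV_lebesgue_measure.
Context {R : realType}.
Local Open Scope ereal_scope.

Definition rV_cons (n : nat) (p : R * 'rV[R]_n) : 'rV[R]_n.+1 :=
  \row_i (if unlift ord0 i is Some j then p.2 ord0 j else p.1).

Lemma measurable_rV_cons (n : nat) : measurable_fun setT (@rV_cons n).
Proof.
apply: measurable_fun_rV => i.
case: (unliftP ord0 i) => [j ->|->].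
  rewrite (_ : _ \o _ = rV_coord j \o snd); last first.
    by apply/funext => p /=; rewrite /rV_coord /rV_cons mxE liftK.
  exact: (measurableT_comp (measurable_rV_coord j) measurable_snd).
rewrite (_ : _ \o _ = fst); first exact: measurable_fst.
by apply/funext => p /=; rewrite /rV_coord /rV_cons mxE unlift_none.
Qed.

Section step.
Variables (n : nat) (m : {sigma_finite_measure set 'rV[R]_n -> \bar R}).

Definition rV_step : set 'rV[R]_n.+1 -> \bar R :=
  pushforward (@lebesgue_measure R \x m) (@rV_cons n).

Let rV_step0 : rV_step set0 = 0.
Proof. by rewrite /rV_step measure0//; exact: measurable_rV_cons. Qed.

Let rV_step_ge0 A : 0 <= rV_step A.
Proof. by rewrite /rV_step measure_ge0//; exact: measurable_rV_cons. Qed.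

Let rV_step_sigma_additive : semi_sigma_additive rV_step.
Proof.
by rewrite /rV_step; apply: measure_semi_sigma_additive => *;
  exact: measurable_rV_cons.
Qed.

HB.instance Definition _ := isMeasure.Build _ _ _ rV_step
  rV_step0 rV_step_ge0 rV_step_sigma_additive.

Let rV_step_sigma_finite : sigma_finite setT rV_step.
Proof.
have /sigma_finiteP[F [FT ndF Foo]] := sigma_finiteT (@lebesgue_measure R).
have /sigma_finiteP[G [GT ndG Goo]] := sigma_finiteT m.
pose g (x : 'rV[R]_n.+1) : R * 'rV[R]_n :=
  (x ord0 ord0, \row_j x ord0 (lift ord0 j)).
have mg : measurable_fun setT g.
  apply: measurable_fun_pair; first exact: (measurable_rV_coord ord0).
  apply: measurable_fun_rV => j.
  rewrite (_ : _ \o _ = rV_coord (lift ord0 j)); last first.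
    by apply/funext => x; rewrite /rV_coord /= mxE.
  exact: measurable_rV_coord.
have gK : cancel (@rV_cons n) g.
  move=> [x y]; rewrite /g /rV_cons !mxE unlift_none; congr pair.
  by apply/rowP => j; rewrite !mxE liftK.
exists (fun k => g @^-1` (F k `*` G k)).
  apply/seteqP; split => // x _.
  have [i _ Fi] : (\bigcup_k F k) (g x).1 by rewrite -FT.
  have [j _ Gj] : (\bigcup_k G k) (g x).2 by rewrite -GT.
  exists (maxn i j) => //; split.
    by move: Fi; exact/subsetPset/ndF/leq_maxl.
  by move: Gj; exact/subsetPset/ndG/leq_maxr.
move=> k; have [mF Fk] := Foo k; have [mG Gk] := Goo k; split.
  by rewrite -[X in measurable X]setTI; apply: mg => //; exact: measurableX.
rewrite /rV_step /pushforward -comp_preimage.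
rewrite (_ : g \o _ = id); last by apply/funext => p /=; rewrite gK.
by rewrite preimage_id product_measure1E// lte_mul_pinfty// ge0_fin_numE.
Qed.

HB.instance Definition _ := @Measure_isSigmaFinite.Build _ _ _ rV_step
  rV_step_sigma_finite.

End step.

Fixpoint lebesgue_rV (n : nat) : {sigma_finite_measure set 'rV[R]_n -> \bar R} :=
  if n is n'.+1 then rV_step (lebesgue_rV n') else \d_(0%R : 'rV[R]_0).

Lemma lebesgue_rV_box (n : nat) (a b : 'rV[R]_n) :
  (forall i, a ord0 i <= b ord0 i)%R ->
  lebesgue_rV n [set x | forall i, (a ord0 i < x ord0 i <= b ord0 i)%R] =
  (\prod_i (b ord0 i - a ord0 i))%:E.
Proof.
elim: n a b => [|n IHn] a b ab.
  by rewrite big_ord0 /= diracE mem_set// => -[].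
pose tl (x : 'rV[R]_n.+1) : 'rV[R]_n := \row_j x ord0 (lift ord0 j).
pose B : set 'rV[R]_n := [set x : 'rV[R]_n | forall i, (tl a ord0 i < x ord0 i <= tl b ord0 i)%R].
have mB : measurable B.
  rewrite (_ : B = \bigcap_(i in [set: 'I_n])
      (rV_coord i @^-1` `]tl a ord0 i, tl b ord0 i]%classic)); last first.
    apply/seteqP; split => x /=; first by move=> h i _ /=; rewrite in_itv/= h.
    by move=> h i; have := h i I; rewrite /= in_itv.
  apply: fin_bigcap_measurable => [|i _]; first exact: finite_finset.
  by rewrite -[X in measurable X]setTI; exact: measurable_rV_coord.
rewrite /= /rV_step /pushforward (_ : _ @^-1` _ =
    `]a ord0 ord0, b ord0 ord0]%classic `*` B); last first.
  apply/seteqP; split => [[x y]/= h|[x y]/= [x0 h] i].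
    split; first by have := h ord0; rewrite in_itv/= mxE unlift_none.
    by move=> i; have := h (lift ord0 i); rewrite !mxE liftK.
  case: (unliftP ord0 i) => [j ->|->]; rewrite !mxE.
    by rewrite liftK; have := h j; rewrite !mxE.
  by rewrite unlift_none; move: x0; rewrite in_itv.
rewrite product_measure1E// IHn; last by move=> i; rewrite !mxE.
rewrite big_ord_recl EFinM; congr (_ * _%:E); last first.
  by apply: eq_bigr => i _; rewrite !mxE.
transitivity (@lebesgue_measure R `]a ord0 ord0, b ord0 ord0]%classic) => //.
rewrite lebesgue_measure_itv/= lte_fin; case: ltP => // ba.
by rewrite (@le_anti _ _ (a ord0 ord0) (b ord0 ord0)) ?subrr// ab ba.
Qed.

End rV_lebesgue_measure.

Section density_integral.
Context d (T : measurableType d) (R : realType).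
Variables (mu nu : {measure set T -> \bar R}) (g : T -> \bar R).
Local Open Scope ereal_scope.

Hypotheses (g0 : forall x, 0 <= g x) (gfin : forall x, g x \is a fin_num).
Hypotheses (mg : measurable_fun setT g).
Hypothesis nuE : forall A, measurable A -> nu A = \int[mu]_(x in A) g x.

Import HBNNSimple.

Lemma ge0_integral_density (f : T -> \bar R) : (forall x, 0 <= f x) ->
  measurable_fun setT f -> \int[nu]_x f x = \int[mu]_x (f x * g x).
Proof.
move=> f0 mf.
pose h := nnsfun_approx measurableT mf.
have -> : \int[nu]_x f x = lim (\int[nu]_x (EFin \o h n) x @[n --> \oo]).
  have fE x : f x = lim ((EFin \o h n) x @[n --> \oo]).
    by apply/esym/cvg_lim => //; exact: cvg_nnsfun_approx.
  under eq_integral => x _ do rewrite fE.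
  apply: monotone_convergence => //.
  - by move=> n; apply/measurable_EFinP.
  - by move=> n x _ //=; rewrite lee_fin.
  - by move=> x _ a b ab; rewrite lee_fin; exact/lefP/nd_nnsfun_approx.
have -> : \int[mu]_x (f \* g) x =
    lim (\int[mu]_x ((EFin \o h n) \* g) x @[n --> \oo]).
  have fg x : f x * g x = lim (((EFin \o h n) \* g) x @[n --> \oo]).
    apply/esym/cvg_lim => //; apply: cvgeZr; first exact: gfin.
    exact: cvg_nnsfun_approx.
  under eq_integral => x _ do rewrite fg.
  apply: monotone_convergence => [//| | |].
  - by move=> n; apply/emeasurable_funM => //; exact/measurable_EFinP.
  - by move=> n x _ /=; rewrite mule_ge0 ?lee_fin.
  - move=> x _ a b ab/=; rewrite lee_wpmul2r ?lee_fin//.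
    exact/lefP/nd_nnsfun_approx.
suff suf n : \int[mu]_x ((EFin \o h n) x * g x) = \int[nu]_x (EFin \o h n) x.
  by congr (lim (_ @ \oo)); apply/funext => n; rewrite -suf.
transitivity (\int[nu]_x
   (\sum_(y \in range (h n)) (y * \1_(h n @^-1` [set y]) x)%:E)); last first.
  by apply: eq_integral => t tE; rewrite /= fimfunE -fsumEFin.
have indich m r : measurable_fun setT
    (fun x => (r * \1_(h m @^-1` [set r]) x)%:E).
  by apply: (measurable_comp measurableT) => //; exact: measurable_funM.
rewrite ge0_integral_fsum//; last by move=> m y Ey; exact: nnfun_muleindic_ge0.
transitivity (\int[mu]_x (\sum_(y \in range (h n))
    (y * \1_(h n @^-1` [set y]) x)%:E * g x)).
  under [RHS]eq_integral => x xE.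
    rewrite -ge0_mule_fsuml => [|y]; last exact: nnfun_muleindic_ge0.
    rewrite fsumEFin // -(fimfunE _ x); over.
  by [].
rewrite ge0_integral_fsum//; last 2 first.
  - by move=> y; exact: emeasurable_funM.
  - by move=> m y Ey; rewrite mule_ge0// nnfun_muleindic_ge0.
apply: eq_fsbigr => r rhn.
under [RHS]eq_integral do rewrite EFinM.
rewrite integralZl_indic_nnsfun => //.
under eq_integral do rewrite EFinM -muleA.
rewrite ge0_integralZl//.
- under eq_integral do rewrite muleC.
  rewrite (eq_integral (g \_ (h n @^-1` [set r]))); last first.
    by move=> x xE; rewrite epatch_indic.
  by rewrite -integral_mkcond -nuE// integral_indic// setIT.
- by apply: emeasurable_funM => //; exact/measurable_EFinP.
- by move=> t Et; rewrite mule_ge0 ?lee_fin.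
- by move: rhn; rewrite inE => -[t _ <-]; rewrite lee_fin.
Qed.

End density_integral.

Section L1_metric.
Context d (T : measurableType d) (R : realType).
Variable mu : {measure set T -> \bar R}.

HB.instance Definition _ := gen_eqMixin (LspaceType1 mu).
HB.instance Definition _ := gen_choiceMixin (LspaceType1 mu).

(* A representative of the class f, with codomain R (the coercion of f to a
   function has the convertible codomain measurableTypeR R). *)
Definition L1fun (f : LspaceType1 mu) : T -> R := f.

Definition L1dist (f g : LspaceType1 mu) : R :=
  fine 'N[mu]_1[EFin \o (L1fun f \- L1fun g)].

Implicit Types f g h : LspaceType1 mu.

Lemma measurable_L1fun f : measurable_fun setT (L1fun f).
Proof. exact: (@measurable_funPT _ _ _ _ (repr (LebesgueSpace.sort f))). Qed.

Lemma L1fun_finite f : ('N[mu]_1[EFin \o L1fun f] < +oo)%E.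
Proof. exact: (@Lebesgue_finite _ _ _ _ _ _ f). Qed.

Lemma L1distE f g :
  (L1dist f g)%:E = (\int[mu]_x `|L1fun f x - L1fun g x|%:E)%E.
Proof.
have mN : measurable_fun setT (\- L1fun g).
  exact: measurableT_comp (measurable_L1fun g).
rewrite /L1dist fineK; first by rewrite Lnorm1.
rewrite ge0_fin_numE ?Lnorm_ge0//.
have : ('N[mu]_1[EFin \o (L1fun f \- L1fun g)%R] <=
    'N[mu]_1[EFin \o L1fun f] + 'N[mu]_1[EFin \o (\- L1fun g)%R])%E.
  by apply: eminkowski => //; exact: measurable_L1fun.
move=> /le_lt_trans; apply.
rewrite lte_add_pinfty ?L1fun_finite//.
rewrite (_ : _ \o _ = \- (EFin \o L1fun g))%E//.
by rewrite oppe_Lnorm L1fun_finite.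
Qed.

Let L1distxx f : L1dist f f = 0.
Proof.
apply: EFin_inj; rewrite L1distE; apply: integral0_eq => x _.
by rewrite subrr normr0.
Qed.

Let L1dist_sym f g : L1dist f g = L1dist g f.
Proof.
by apply: EFin_inj; rewrite !L1distE; under eq_integral do rewrite distrC.
Qed.

Let L1dist_triangle g f h : L1dist f h <= L1dist f g + L1dist g h.
Proof.
have mB f1 f2 : measurable_fun setT (fun x => `|L1fun f1 x - L1fun f2 x|%:E).
  apply/measurable_EFinP; apply: measurableT_comp => //.
  by apply: measurable_funB; exact: measurable_L1fun.
rewrite -lee_fin EFinD !L1distE -ge0_integralD//.
apply: ge0_le_integral => //.
- exact: emeasurable_funD.
- by move=> x _; rewrite -EFinD lee_fin ler_distD.
Qed.

Let L1dist_positivity f g : L1dist f g = 0%R -> f = g.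
Proof.
move=> fg0; have {}fg0 := congr1 EFin fg0; rewrite L1distE in fg0.
have mB : measurable_fun setT (EFin \o (L1fun f \- L1fun g)).
  by apply/measurable_EFinP; apply: measurable_funB; exact: measurable_L1fun.
have {}fg0 := Lnorm_eq0_eq0 mB lte01 (etrans (Lnorm1 mu (EFin \o (L1fun f \- L1fun g))) fg0).
have fg : LebesgueSpace.sort f = LebesgueSpace.sort g.
  rewrite -[LHS]reprK -[RHS]reprK; apply/eqquotP/asboolP.
  apply: filterS fg0 => x /(_ I) /= [] /eqP.
  by rewrite subr_eq0 => /eqP.
move: f g fg {fg0 mB} => [f [[hf]]] [g [[hg]]] /= fg.
by subst g; rewrite (Prop_irrelevance hf hg).
Qed.

HB.instance Definition _ := @isMetric.Build R (LspaceType1 mu)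
  L1dist L1distxx L1dist_positivity L1dist_sym L1dist_triangle.

End L1_metric.

Section domains_and_weights.
Context {R : realType} {n : nat}.
Implicit Types D E : set 'rV[R]_n.

Definition domain D := [/\ D !=set0, open D & connected D].

Definition positive_continuous D (phi : 'rV[R]_n -> R) :=
  {within D, continuous phi} /\ (forall x, D x -> 0 < phi x).

Lemma measurable_fun_positive_continuous D phi :
  domain D -> positive_continuous D phi -> measurable_fun D phi.
Proof.
move=> [_ oD _] [/continuousP cphi _].
apply: (measurability _ (RGenOpens.measurableE R)).
move=> _ [_ [a [b ->] <-]].
have /cphi/open_subspaceP[V oV VD] : open `]a, b[%classic by exact: interval_open.
by rewrite setIC -VD; apply: measurableI; exact: open_measurable_rV.
Qed.

Local Open Scope ereal_scope.

(* The measure phi dx on D, extended by 0 outside D. The proof arguments are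
   not used by the formula: they make it a measure by inference. *)
Definition weighted_measure D (phi : 'rV[R]_n -> R)
    (hD : domain D) (hphi : positive_continuous D phi) :
    set 'rV[R]_n -> \bar R :=
  fun A => \int[lebesgue_rV n]_(x in A `&` D) (phi x)%:E.

Section weighted_measure.
Variables (D : set 'rV[R]_n) (phi : 'rV[R]_n -> R).
Variables (hD : domain D) (hphi : positive_continuous D phi).

Let g : 'rV[R]_n -> \bar R := (EFin \o phi) \_ D.

Let mD : measurable D.
Proof. by case: hD => _ oD _; exact: open_measurable_rV. Qed.

Let g0 x : 0 <= g x.
Proof.
rewrite /g patchE; case: ifPn => // /set_mem Dx.
by rewrite lee_fin ltW//; exact: hphi.2.
Qed.

Let gfin x : g x \is a fin_num.
Proof. by rewrite /g patchE; case: ifPn. Qed.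

Let mg : measurable_fun setT g.
Proof.
apply/(measurable_restrictT _ mD)/measurable_EFinP.
exact: measurable_fun_positive_continuous hD hphi.
Qed.

Let weighted_measureE A :
  weighted_measure hD hphi A = \int[lebesgue_rV n]_(x in A) g x.
Proof. by rewrite /weighted_measure integral_mkcondr. Qed.

Let weighted_measure0 : weighted_measure hD hphi set0 = 0.
Proof. by rewrite weighted_measureE integral_set0. Qed.

Let weighted_measure_ge0 A : 0 <= weighted_measure hD hphi A.
Proof. by rewrite weighted_measureE integral_ge0. Qed.

Let weighted_measure_sigma_additive :
  semi_sigma_additive (weighted_measure hD hphi).
Proof.
move=> F mF tF mUF; rewrite weighted_measureE ge0_integral_bigcup//; last first.
  exact: measurable_funTS.
under eq_fun do under eq_bigr do rewrite weighted_measureE.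
by apply: is_cvg_ereal_nneg_natsum_cond => k _ _; exact: integral_ge0.
Qed.

HB.instance Definition _ := isMeasure.Build _ _ _ (weighted_measure hD hphi)
  weighted_measure0 weighted_measure_ge0 weighted_measure_sigma_additive.

Lemma ge0_integral_weighted (f : 'rV[R]_n -> \bar R) :
  (forall x, 0 <= f x) -> measurable_fun setT f ->
  \int[weighted_measure hD hphi]_x f x =
  \int[lebesgue_rV n]_(x in D) (f x * (phi x)%:E).
Proof.
move=> f0 mf; rewrite (@ge0_integral_density _ _ _ (lebesgue_rV n) _ g)//; last first.
  by move=> A _; exact: weighted_measureE.
rewrite [RHS]integral_mkcond; apply: eq_integral => x _.
by rewrite /g !patchE; case: ifPn => //; rewrite mule0.
Qed.

End weighted_measure.

End domains_and_weights.

(* L^1(D, phi): classes of functions on R^n modulo equality a.e. for the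
   measure phi dx on D, hence modulo equality a.e. on D since phi > 0 there.
   Representatives are Borel; every Lebesgue measurable function is a.e. equal
   to a Borel one. See L1_weighted_distE for the distance. *)
Notation L1_weighted hD hphi := (LspaceType1 (weighted_measure hD hphi)).

Section norming.
Context {R : realType} {n : nat}.
Local Open Scope ereal_scope.

Lemma L1_weighted_distE (D : set 'rV[R]_n) (phi : 'rV[R]_n -> R)
    (hD : domain D) (hphi : positive_continuous D phi)
    (f g : L1_weighted hD hphi) :
  (mdist f g)%:E =
  \int[lebesgue_rV n]_(x in D) (`|L1fun f x - L1fun g x| * phi x)%:E.
Proof.
rewrite [LHS]L1distE ge0_integral_weighted//.
apply/measurable_EFinP; apply: measurableT_comp => //.
by apply: measurable_funB; exact: measurable_L1fun.
Qed.

Definition weighted_norm (phi : 'rV[R]_n -> R) (E : set 'rV[R]_n)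
    (u : 'rV[R]_n -> \bar R) : \bar R :=
  \int[lebesgue_rV n]_(x in E) (`|u x| * (phi x)%:E).

(* closed ball for the Euclidean norm (the norm of 'rV[R]_n is the sup norm) *)
Definition euclidean_ball (x : 'rV[R]_n) (r : R) : set 'rV[R]_n :=
  [set y | (\sum_i (y ord0 i - x ord0 i) ^+ 2 <= r ^+ 2)%R].

Definition ball_mean (u : 'rV[R]_n -> \bar R) (x : 'rV[R]_n) (r : R) : \bar R :=
  (fine (lebesgue_rV n (euclidean_ball x r)))^-1%:E *
  \int[lebesgue_rV n]_(y in euclidean_ball x r) u y.

(* Upper semicontinuous functions D -> [-oo, +oo[ that are dominated by their
   volume means on the closed balls contained in D. The values of u outside D
   are irrelevant. *)
Definition subharmonic (D : set 'rV[R]_n) (u : 'rV[R]_n -> \bar R) :=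
  [/\ forall x, D x -> u x < +oo,
      forall x (a : R), D x -> u x < a%:E ->
        \forall y \near x, D y -> u y < a%:E
    & forall x (r : R), (0 < r)%R -> euclidean_ball x r `<=` D ->
        u x <= ball_mean u x r].

Definition negative_subharmonic (D : set 'rV[R]_n) (u : 'rV[R]_n -> \bar R) :=
  [/\ subharmonic D u,
      forall x, D x -> u x <= 0
    & exists2 x, D x & u x != -oo].

Definition relatively_compact (A D : set 'rV[R]_n) :=
  compact (closure A) /\ closure A `<=` D.

Definition norming (D : set 'rV[R]_n) (phi : 'rV[R]_n -> R) :=
  [/\ positive_continuous D phi,
      forall u, negative_subharmonic D u -> weighted_norm phi D u < +oo,
      forall F : set 'rV[R]_n, compact F -> F `<=` D ->
        exists2 C : R, (0 < C)%R &
          forall u, negative_subharmonic D u ->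
            forall x, F x -> u x <= - (C%:E * weighted_norm phi D u)
    & forall Dj : nat -> set 'rV[R]_n,
        (forall j, domain (Dj j) /\ relatively_compact (Dj j) D) ->
        (forall j, Dj j `<=` Dj j.+1) ->
        \bigcup_j Dj j = D ->
        exists eps : nat -> R,
          [/\ forall j, (0 < eps j)%R,
              eps @ \oo --> (0 : R)%R
            & forall u, negative_subharmonic D u ->
                forall j, weighted_norm phi (D `\` Dj j) u <=
                  (eps j)%:E * weighted_norm phi D u]].

Lemma norming_positive_continuous (D : set 'rV[R]_n) (phi : 'rV[R]_n -> R) :
  norming D phi -> positive_continuous D phi.
Proof. by case. Qed.

(* The classes in L^1(D, phi) of the u in SH^-(D) with norm at most 1. As u may
   take the value -oo, u and a representative of its class agree only a.e. *)
Definition SH1 (D : set 'rV[R]_n) (phi : 'rV[R]_n -> R)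
    (hD : domain D) (hphi : positive_continuous D phi) :
    set (L1_weighted hD hphi) :=
  [set f | exists u : 'rV[R]_n -> \bar R,
    [/\ negative_subharmonic D u,
        weighted_norm phi D u <= 1
      & {ae lebesgue_rV n, forall x, D x -> (L1fun f x)%:E = u x}]].

End norming.
Arguments SH1 {R n D phi} hD hphi _.

(* Main.v *)
(* Put g = |u| = -u for u in SH^-(D), and let M_r g be the volume mean of g over
   balls of radius r, so that M_r g <= g.  Testing g - M_r g >= 0 against a
   Lipschitz cutoff psi and moving the mean onto psi by Tonelli shows that the
   L^1 norm of g - M_r g on a ball is O(r) times the L^1 norm of g on a larger
   ball.  In turn M_r g is determined in L^1 of a ball, up to a small error, by
   its values at finitely many points, since the region swept by a ball whose
   centre moves slightly has small measure.  These values being bounded, every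
   ultrafilter on SH^-_1 is Cauchy in L^1_loc, hence in L^1(D, phi) because
   condition (3) of norming functions controls the norm near the boundary.
   Finally M_r g <= g passes to limits by Fatou's lemma, and such a g has the
   subharmonic representative u = - sup_r M_r g: this supremum is lower
   semicontinuous, it is at most g almost everywhere since only rational radii
   matter, and it is at least g by the O(r) estimate. *)

Require Import Defs.
From HB Require Import structures.
From mathcomp Require Import all_boot all_order all_algebra.
From mathcomp Require Import all_classical all_reals all_analysis.
From mathcomp Require Import measurable_realfun ring lra.

Set Implicit Arguments.
Unset Strict Implicit.
Unset Printing Implicit Defensive.

Import Order.TTheory GRing.Theory Num.Theory.
Import numFieldNormedType.Exports.

Local Open Scope classical_set_scope.
Local Open Scope ring_scope.

(** * Lebesgue measure on R^n *)

Section lebesgue_rV_facts.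
Context {R : realType}.
Local Open Scope ereal_scope.

(** An element of L^1 is finite and defined only a.e., while a subharmonic function has a value,
    possibly -oo, at every point. Between the two ends of the proof everything is therefore stated
    for the nonnegative real function [|L1fun f|], with the mean inequality a.e. for each radius;
    the price is that a genuine subharmonic function must be rebuilt from the limit.

    Means are kept unnormalised, as integrals over [euclidean_ball x r] compared with
    [euclidean_ball_volume]: such integrals are monotone under inclusion of balls, and they come
    from the symmetric kernel [sqd x z <= r ^+ 2].

    The two geometries are mixed on purpose: neighbourhoods are sup norm balls, means are over
    Euclidean balls.

    Ultrafilters replace extraction of subsequences: along an ultrafilter a bounded real quantity is
    confined to an arbitrarily short interval, and finitely many such quantities are confined at
    once. Positive dimension enters through the nullity of spheres, which gives the smallness of
    thin annuli and the left continuity of means in the radius. *)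

Lemma lebesgue_measure_translation (a : R) (A : set R) : measurable A ->
  lebesgue_measure ((fun t => t + a)%R @^-1` A) = lebesgue_measure A.
Proof.
move=> mA.
rewrite -[LHS]/(pushforward lebesgue_measure
  ((fun t => t + a)%R : _ -> measurableTypeR R) A).
apply/esym/lebesgue_measure_unique => //=.
  by move=> mt; apply: measurable_funD => //; exact: measurable_id.
move=> mt _ [[u v] /= uv <-].
rewrite /pushforward (_ : _ @^-1` _ = `](u - a)%R, (v - a)%R]%classic);
  last first.
  by apply/seteqP; split => t /=; rewrite !in_itv/= ltrBlDr lerBrDr.
rewrite !lebesgue_measure_itv/= !lte_fin ltrD2r; case: ifP => // _.
by rewrite -!EFinD; congr EFin; ring.
Qed.

(** Induction on the dimension: the slice over [t] of the translated set is a translate, by the tail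
    of [a], of the slice of [A] over [t + a ord0 ord0]. Invariance on the line then handles the
    first coordinate. *)
Lemma lebesgue_rV_translation n (a : 'rV[R]_n) (A : set 'rV[R]_n) :
  measurable A ->
  lebesgue_rV n ((fun x => x + a)%R @^-1` A) = lebesgue_rV n A.
Proof.
elim: n a A => [|n IHn] a A mA.
  rewrite /= (_ : _ @^-1` _ = A)//; apply/seteqP; split => x /=;
    by rewrite (_ : (x + a)%R = x)//; apply/rowP => -[].
pose tl : 'rV[R]_n := (\row_j a ord0 (lift ord0 j))%R.
have mA' : measurable (@rV_cons R n @^-1` A).
  by rewrite -[X in measurable X]setTI; exact: measurable_rV_cons.
rewrite /= /rV_step /pushforward.
have consD (t : R) (y : 'rV[R]_n) :
    (rV_cons (t, y) + a)%R = rV_cons ((t + a ord0 ord0)%R, (y + tl)%R).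
  apply/rowP => i; rewrite /rV_cons !mxE.
  case: (unliftP ord0 i) => [j ->|->]; by rewrite /= ?mxE.
pose h t := lebesgue_rV n (xsection (@rV_cons R n @^-1` A) t).
have mh : measurable_fun [set: measurableTypeR R] h.
  exact: (measurable_fun_xsection (lebesgue_rV n) mA').
have mt : measurable_fun [set: measurableTypeR R]
    ((fun t => t + a ord0 ord0)%R : measurableTypeR R -> measurableTypeR R).
  by apply: measurable_funD => //; exact: measurable_id.
transitivity (\int[@lebesgue_measure R]_t (h \o (fun t => t +
  a ord0 ord0)%R) t).
  apply: eq_integral => t _ /=; rewrite /h.
  rewrite -[RHS](IHn tl); last exact: (measurable_xsection _ mA').
  congr (lebesgue_rV n _).
  by apply/seteqP; split => y; rewrite /xsection /= !inE /= consD.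
transitivity (\int[pushforward (@lebesgue_measure R)
    ((fun t => t + a ord0 ord0)%R : _ -> measurableTypeR R)]_t h t).
  by rewrite ge0_integral_pushforward// => t _; exact: measure_ge0.
transitivity (\int[@lebesgue_measure R]_t h t) => //.
apply: eq_measure_integral => //= B mB _.
exact: lebesgue_measure_translation.
Qed.

(* [euclidean_ball x r] is convertible to [[set y | sqd x y <= r ^+ 2]]. *)
Definition sqd n (x y : 'rV[R]_n) : R := (\sum_i (y ord0 i - x ord0 i) ^+ 2)%R.

Lemma sqdC n (x y : 'rV[R]_n) : sqd x y = sqd y x.
Proof. by apply: eq_bigr => i _; rewrite -sqrrN opprB. Qed.

Lemma measurable_sqd2 n :
  measurable_fun setT (fun p : 'rV[R]_n * 'rV[R]_n => sqd p.1 p.2).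
Proof.
apply: measurable_sum => i; apply: measurable_funX.
by apply: measurable_funB;
  apply: (measurableT_comp (measurable_rV_coord i)).
Qed.

Lemma measurable_sqd n (x : 'rV[R]_n) : measurable_fun setT (sqd x).
Proof.
apply: measurable_sum => i; apply: measurable_funX.
by apply: measurable_funB => //; exact: (measurable_rV_coord i).
Qed.

Lemma measurable_sqd_set n (x : 'rV[R]_n) (A : set R) : measurable A ->
  measurable (sqd x @^-1` A).
Proof.
by move=> mA; rewrite -[X in measurable X]setTI; exact: measurable_sqd.
Qed.

Lemma measurable_euclidean_ball n (x : 'rV[R]_n) r :
  measurable (euclidean_ball x r).
Proof.
rewrite (_ : euclidean_ball x r = sqd x @^-1` `]-oo, (r ^+ 2)%R]%classic).
  exact: measurable_sqd_set.
by apply/seteqP; split => y /=; rewrite in_itv.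
Qed.

(** Makes the volumes of balls and annuli independent of their centre. *)
Lemma lebesgue_rV_sqd n (x : 'rV[R]_n) (A : set R) : measurable A ->
  lebesgue_rV n (sqd x @^-1` A) = lebesgue_rV n (sqd 0%R @^-1` A).
Proof.
move=> mA.
rewrite -(@lebesgue_rV_translation n (- x)%R (sqd 0%R @^-1` A)); last first.
  exact: measurable_sqd_set.
congr (lebesgue_rV n _); apply/seteqP.
have sqdE y : sqd 0%R (y - x)%R = sqd x y.
  by apply: eq_bigr => i _; rewrite !mxE subr0.
by split => y /=; rewrite sqdE.
Qed.

(** A line parallel to the first axis meets the sphere in at most two points, so Tonelli along these
    lines gives 0. *)
Lemma lebesgue_rV_sphere n (x : 'rV[R]_n.+1) (c : R) :
  lebesgue_rV n.+1 (sqd x @^-1` [set c]) = 0.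
Proof.
pose S := @rV_cons R n @^-1` (sqd x @^-1` [set c]).
have mS : measurable S.
  rewrite -[X in measurable X]setTI; apply: measurable_rV_cons => //.
  exact: measurable_sqd_set.
have mS2 := measurable_fun_ysection (@lebesgue_measure R) mS.
rewrite /= /rV_step /pushforward -/S.
(* The product measure is defined by slicing over the first coordinate; uniqueness of the product
   allows slicing over the other coordinates instead. *)
rewrite (product_measure_unique (m' := @lebesgue_measure R \x^ lebesgue_rV
  n))//; last first.
  by move=> A B mA mB; exact: product_measure2E.
apply: integral0_eq => y _ /=.
apply: (@subset_measure0 _ _ _ lebesgue_measure _
  [set x ord0 ord0 + Num.sqrt (c - sqd (\row_j x ord0 (lift ord0 j)) y);
   x ord0 ord0 - Num.sqrt (c - sqd (\row_j x ord0 (lift ord0 j)) y)]%R).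
- exact: measurable_ysection.
- by apply: measurableU; exact: measurable_set1.
- move=> t; rewrite /ysection /S /= inE /= /sqd /rV_cons big_ord_recl !mxE
    unlift_none /=.
  under eq_bigr do rewrite !mxE liftK.
  rewrite -/(sqd _ _) => h.
  have -> : (c - \sum_(i < n) (y ord0 i - (\row_j x ord0 (lift ord0 j)) ord0 i)
    ^+ 2
     = (t - x ord0 ord0) ^+ 2)%R.
    by under eq_bigr do rewrite mxE; lra.
  rewrite sqrtr_sqr; case: (ger0P (t - x ord0 ord0)%R) => _; [left|right]; ring.
- exact/countable_lebesgue_measure0/finite_set_countable.
Qed.

Let box n (a b : 'rV[R]_n) : set 'rV[R]_n :=
  [set x | forall i, (a ord0 i < x ord0 i <= b ord0 i)%R].

Let measurable_box n (a b : 'rV[R]_n) : measurable (box a b).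
Proof.
rewrite (_ : box a b = \bigcap_(i in [set: 'I_n])
    (rV_coord i @^-1` `]a ord0 i, b ord0 i]%classic)); last first.
  apply/seteqP; split => x /=; first by move=> h i _ /=; rewrite in_itv/= h.
  by move=> h i; have := h i I; rewrite /= in_itv.
apply: fin_bigcap_measurable => [|i _]; first exact: finite_finset.
by rewrite -[X in measurable X]setTI; exact: measurable_rV_coord.
Qed.

Let lebesgue_box n (x : 'rV[R]_n) (e : R) : (0 < e)%R ->
  lebesgue_rV n (box (x - const_mx e)%R (x + const_mx e)%R) =
  ((2 * e) ^+ n)%:E.
Proof.
move=> e0; rewrite lebesgue_rV_box; last by move=> i; rewrite !mxE; lra.
congr EFin; rewrite -[in RHS](card_ord n) -prodr_const.
by apply: eq_bigr => i _; rewrite !mxE; ring.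
Qed.

Lemma lebesgue_rV_ball_fin n (x : 'rV[R]_n) (e : R) :
  lebesgue_rV n (ball x e) < +oo.
Proof.
have [e0|e0] := ltP 0%R e; last first.
  rewrite (_ : ball x e = set0) ?measure0//; apply/seteqP; split => // y.
  by move=> [/lt_le_trans/(_ e0)]; rewrite ltxx.
apply: (@le_lt_trans _ _ (lebesgue_rV n (box (x - const_mx e)%R (x +
  const_mx e)%R))).
  apply: le_measure; rewrite ?inE//.
  - exact: measurable_rV_ball.
  - exact: measurable_box.
  move=> y [_ h] i; have := h ord0 i.
  by rewrite /ball/= !mxE ltr_distlC => /andP[-> /ltW ->].
by rewrite lebesgue_box// ltry.
Qed.

Lemma lebesgue_rV_ball_gt0 n (x : 'rV[R]_n) (e : R) : (0 < e)%R ->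
  0 < lebesgue_rV n (ball x e).
Proof.
move=> e0; have e20 : (0 < e / 2)%R by rewrite divr_gt0.
apply: (@lt_le_trans _ _ (lebesgue_rV n
    (box (x - const_mx (e / 2))%R (x + const_mx (e / 2))%R))).
  by rewrite lebesgue_box// lte_fin exprn_gt0//; lra.
apply: le_measure; rewrite ?inE//.
- exact: measurable_box.
- exact: measurable_rV_ball.
move=> y h; split => // i j; rewrite (ord1 i); have := h j.
by rewrite !mxE /ball/= ltr_distlC => /andP[? ?]; lra.
Qed.

End lebesgue_rV_facts.

(** * Integrals over Euclidean balls *)

Section ball_integrals.
Context {R : realType}.
Local Open Scope ereal_scope.

Lemma continuous_measurable_rV n (f : 'rV[R]_n -> R) :
  continuous f -> measurable_fun setT f.
Proof.
move=> cf; apply: (measurability _ (RGenOpens.measurableE R)).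
move=> _ [_ [a [b ->] <-]]; rewrite setTI; apply: open_measurable_rV.
by apply: open_comp => [x _|]; [exact: cf|exact: interval_open].
Qed.

Lemma rV_ballE n (x : 'rV[R]_n) e : ball x e = [set y | `|x - y| < e]%R.
Proof. by rewrite -ball_normE. Qed.

Lemma rV_normP n (x : 'rV[R]_n) (e : R) : (0 <= e)%R ->
  reflect (forall i, `|x ord0 i| <= e)%R (`|x| <= e)%R.
Proof.
move=> e0; apply: (iffP idP) => [h i|h].
  apply: le_trans h; rewrite [leRHS]/Num.norm/= mx_normrE.
  by apply/bigmax_geP; right; exists (ord0, i).
rewrite [leLHS]/Num.norm/= mx_normrE; apply/bigmax_leP; split => // -[i j] _ /=.
by rewrite (ord1 i).
Qed.

Lemma norm_le_sqd n (x y : 'rV[R]_n) (r : R) : (0 <= r)%R ->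
  (sqd x y <= r ^+ 2)%R -> (`|x - y| <= r)%R.
Proof.
move=> r0 h; apply/(rV_normP _ r0) => i; rewrite !mxE.
rewrite -(@ler_pXn2r _ 2)// ?nnegrE// ?normr_ge0// real_normK ?num_real//.
apply: le_trans h; rewrite /sqd (bigD1 i)//= -sqrrN opprB lerDl.
by apply: sumr_ge0 => j _; exact: sqr_ge0.
Qed.

Lemma sqd_le_norm n (x y : 'rV[R]_n) (e : R) :
  (`|x - y| <= e -> sqd x y <= n%:R * e ^+ 2)%R.
Proof.
move=> h; have e0 : (0 <= e)%R by exact: le_trans h.
rewrite (_ : n%:R * _ = \sum_(i < n) e ^+ 2)%R; last first.
  by rewrite sumr_const card_ord mulr_natl.
apply: ler_sum => i _; move/(rV_normP _ e0): h => /(_ i); rewrite !mxE => h.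
by rewrite -real_normK ?num_real// ler_pXn2r ?nnegrE// distrC.
Qed.

(** In each coordinate, with [a = y - x] and [b = z - x], the difference of the squares is
    [b^2 - (b - a)^2 = a (2 b - a)]. *)
Lemma sqd_perturb n (x y z : 'rV[R]_n) (M d : R) :
  (`|x - z| <= M -> `|x - y| <= d ->
   `|sqd x z - sqd y z| <= n%:R * (2 * M * d + d ^+ 2))%R.
Proof.
move=> hM hd; have M0 : (0 <= M)%R by exact: le_trans hM.
have d0 : (0 <= d)%R by exact: le_trans hd.
rewrite /sqd -sumrB (le_trans (ler_norm_sum _ _ _))//.
rewrite (_ : n%:R * _ = \sum_(i < n) (2 * M * d + d ^+ 2))%R; last first.
  by rewrite sumr_const card_ord mulr_natl.
apply: ler_sum => i _; move/(rV_normP _ M0): hM => /(_ i); rewrite !mxE => hM.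
move/(rV_normP _ d0): hd => /(_ i); rewrite !mxE => hd.
rewrite (_ : _ - _ = (y ord0 i - x ord0 i) * (2 * (z ord0 i - x ord0 i) - (y
  ord0 i - x ord0 i)))%R; last by ring.
rewrite normrM [leRHS](_ : _ = d * (2 * M + d))%R; last by ring.
apply: ler_pM => //; first by rewrite distrC.
rewrite (le_trans (ler_normB _ _))// lerD//; last by rewrite distrC.
by rewrite normrM ger0_norm// ler_pM2l// distrC.
Qed.

Lemma euclidean_ballE n (x : 'rV[R]_n) r :
  euclidean_ball x r = sqd x @^-1` `]-oo, (r ^+ 2)%R]%classic.
Proof. by apply/seteqP; split => y /=; rewrite in_itv. Qed.

(** The sup norm is at most the Euclidean norm, so this inclusion loses no dimensional factor. *)
Lemma subset_euclidean_ball n (x y : 'rV[R]_n) (r d e : R) : (0 <= r)%R ->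
  (`|y - x| <= d)%R -> (r + d < e)%R -> euclidean_ball x r `<=` ball y e.
Proof.
move=> r0 yx rde z /(norm_le_sqd r0) h; rewrite rV_ballE /=.
by rewrite (le_lt_trans (ler_distD x _ _))// (le_lt_trans _ rde)// addrC lerD.
Qed.

Definition euclidean_ball_volume n (r : R) : R :=
  fine (lebesgue_rV n (euclidean_ball 0%R r)).

Lemma lebesgue_rV_bounded n (x : 'rV[R]_n) e (A : set 'rV[R]_n) :
  measurable A -> A `<=` ball x e -> lebesgue_rV n A < +oo.
Proof.
move=> mA AB; apply: le_lt_trans (lebesgue_rV_ball_fin x e).
by apply: le_measure; rewrite ?inE//; exact: measurable_rV_ball.
Qed.

Lemma lebesgue_euclidean_ball n (x : 'rV[R]_n) r : (0 <= r)%R ->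
  lebesgue_rV n (euclidean_ball x r) = (euclidean_ball_volume n r)%:E.
Proof.
move=> r0; rewrite [RHS]fineK;
  first by rewrite !euclidean_ballE lebesgue_rV_sqd.
rewrite ge0_fin_numE//.
apply: (@lebesgue_rV_bounded _ 0%R (r + 1)%R);
  first exact: measurable_euclidean_ball.
by apply: (@subset_euclidean_ball _ _ _ _ 0%R) => //;
  rewrite ?subrr ?normr0// addr0 ltrDl.
Qed.

Lemma euclidean_ball_volume_gt0 n r : (0 < r)%R -> (0 < euclidean_ball_volume n
  r)%R.
Proof.
move=> r0; rewrite -lte_fin -(lebesgue_euclidean_ball 0%R (ltW r0)).
(* A sup norm ball of radius [e] lies in the Euclidean ball of radius [r] once [n e^2 <= r^2];
   dividing by [n.+1] also covers [n = 0]. *)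
have e0 : (0 < r / n.+1%:R)%R by rewrite divr_gt0.
apply: lt_le_trans (lebesgue_rV_ball_gt0 (0%R : 'rV[R]_n) e0) _.
apply: le_measure; rewrite ?inE//; first exact: measurable_rV_ball.
  exact: measurable_euclidean_ball.
move=> y; rewrite rV_ballE /= => /ltW /sqd_le_norm h; apply: le_trans h _.
rewrite expr_div_n mulrCA ler_piMr ?sqr_ge0// ler_pdivrMr ?exprn_gt0// mul1r.
by rewrite -natrX ler_nat (@leq_trans n.+1)// leq_pmulr.
Qed.

Lemma le_euclidean_ball_volume n (q r : R) : (0 <= q)%R -> (q <= r)%R ->
  (euclidean_ball_volume n q <= euclidean_ball_volume n r)%R.
Proof.
move=> q0 qr; have r0 := le_trans q0 qr.
rewrite -lee_fin -!(lebesgue_euclidean_ball 0%R)//.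
apply: le_measure; rewrite ?inE//; [exact: measurable_euclidean_ball..|].
by move=> y /= h; apply: le_trans h _; rewrite ler_pXn2r.
Qed.

(** The kernel [\1_A (sqd x z)] is symmetric in [x] and [z]. A half-line for [A] gives the integrals
    over balls, an interval around [r ^+ 2] those over annuli. *)
Lemma sqd_tonelli n (A : set R) (a b : 'rV[R]_n -> \bar R) :
  measurable A -> measurable_fun setT a -> measurable_fun setT b ->
  (forall x, 0 <= a x) -> (forall x, 0 <= b x) ->
  \int[lebesgue_rV n]_x (a x * \int[lebesgue_rV n]_(z in sqd x @^-1` A) b z) =
  \int[lebesgue_rV n]_z (b z * \int[lebesgue_rV n]_(x in sqd z @^-1` A) a x).
Proof.
move=> mA ma mb a0 b0.
pose f (p : 'rV[R]_n * 'rV[R]_n) := a p.1 * b p.2 * (\1_A (sqd p.1 p.2))%:E.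
have mf : measurable_fun setT f.
  apply: emeasurable_funM.
    apply: emeasurable_funM.
      exact: (measurableT_comp ma measurable_fst).
    exact: (measurableT_comp mb measurable_snd).
  apply/measurable_EFinP.
  exact: (measurableT_comp (measurable_indic mA) (@measurable_sqd2 R n)).
have f0 p : 0 <= f p by rewrite !mule_ge0// lee_fin.
have := fubini_tonelli (m1 := lebesgue_rV n) (m2 := lebesgue_rV n) f mf f0.
have E (c d : 'rV[R]_n -> \bar R) x : measurable_fun setT d -> (forall x, 0 <=
  c x) ->
    (forall x, 0 <= d x) ->
    c x * \int[lebesgue_rV n]_(z in sqd x @^-1` A) d z =
    \int[lebesgue_rV n]_z (c x * (d z * (\1_A (sqd x z))%:E)).
  move=> md c0 d0; rewrite ge0_integralZl//.
  - rewrite [in LHS]integral_mkcond; congr (c x * _); apply: eq_integral => z _.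
    rewrite patchE indicE; case: ifPn => [/set_mem /= h|/negP h].
      by rewrite mem_set// mule1.
    by rewrite memNset ?mule0// => h'; apply: h; rewrite inE.
  - apply: emeasurable_funM => //; apply/measurable_EFinP.
    exact: (measurableT_comp (measurable_indic mA) (measurable_sqd x)).
  - by move=> z _; rewrite mule_ge0// lee_fin.
move=> H.
transitivity (\int[lebesgue_rV n]_x \int[lebesgue_rV n]_y f (x, y)).
  apply: eq_integral => x _; rewrite (E a b x mb a0 b0).
  by apply: eq_integral => z _; rewrite muleA.
rewrite H; apply: eq_integral => z _; rewrite (E b a z ma b0 a0).
by apply: eq_integral => x _; rewrite /f /= (muleC (a x)) -muleA sqdC.
Qed.

Lemma measurable_sqd_integral n (A : set R) (b : 'rV[R]_n -> \bar R) :
  measurable A -> measurable_fun setT b -> (forall x, 0 <= b x) ->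
  measurable_fun setT (fun x => \int[lebesgue_rV n]_(z in sqd x @^-1` A) b z).
Proof.
move=> mA mb b0.
pose f (p : 'rV[R]_n * 'rV[R]_n) := b p.2 * (\1_A (sqd p.1 p.2))%:E.
have mf : measurable_fun setT f.
  apply: emeasurable_funM.
    exact: (measurableT_comp mb measurable_snd).
  apply/measurable_EFinP.
  exact: (measurableT_comp (measurable_indic mA) (@measurable_sqd2 R n)).
have f0 p : 0 <= f p by rewrite !mule_ge0// lee_fin.
rewrite (_ : (fun x => _) = (fubini_F (lebesgue_rV n) f : 'rV[R]_n -> \bar R));
  last first.
  apply/funext => x; rewrite integral_mkcond; apply: eq_integral => z _.
  rewrite patchE /f indicE; case: ifPn => [/set_mem /= h|/negP h].
    by rewrite mem_set// mule1.
  by rewrite memNset ?mule0// => h'; apply: h; rewrite inE.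
exact: (measurable_fun_fubini_tonelli_F (m2 := lebesgue_rV n) f mf f0).
Qed.

Lemma measurable_ball_integral n (r : R) (b : 'rV[R]_n -> \bar R) :
  measurable_fun setT b -> (forall x, 0 <= b x) ->
  measurable_fun setT
    (fun x => \int[lebesgue_rV n]_(z in euclidean_ball x r) b z).
Proof.
move=> mb b0; under eq_fun do rewrite euclidean_ballE.
exact: measurable_sqd_integral.
Qed.

End ball_integrals.

(** * Deviation of a supermean function from its means *)

Section mean_deviation.
Context {R : realType}.
Local Open Scope ereal_scope.

Lemma rV_ball_sub n (x : 'rV[R]_n) d e : (d <= e)%R -> ball x d `<=` ball x e.
Proof. by move=> de y; exact: le_ball. Qed.

Lemma subset_integral_fin n (g : 'rV[R]_n -> \bar R) (A B : set 'rV[R]_n) :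
  measurable A -> measurable B -> A `<=` B ->
  measurable_fun setT g -> (forall x, 0 <= g x) ->
  \int[lebesgue_rV n]_(z in B) g z < +oo ->
  \int[lebesgue_rV n]_(z in A) g z < +oo.
Proof.
move=> mA mB AB mg g0; apply: le_lt_trans.
by apply: ge0_subset_integral => //; exact: measurable_funTS.
Qed.

Variables (n : nat) (x0 : 'rV[R]_n) (rho r : R).
Notation mu := (lebesgue_rV n).
Notation V := (euclidean_ball_volume n r).
Hypotheses (r0 : (0 < r)%R) (rrho : (r <= rho)%R).

Let rho0 : (0 < rho)%R. Proof. exact: lt_le_trans rrho. Qed.

Let rho23 : (2 * rho + r <= 3 * rho)%R.
Proof. by move: rrho; lra. Qed.

Let rho_le : (2 * rho <= 3 * rho)%R.
Proof. by move: rho0; lra. Qed.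

(** A tent of slope 1/rho, not truncated at 1: a lower bound 1 on the inner ball suffices, and the
    height 2 bounds it above. *)
Let psi (x : 'rV[R]_n) : R := Num.max 0%R (2 - `|x - x0| / rho)%R.

Let psi_ge0 x : (0 <= psi x)%R. Proof. by rewrite le_max lexx. Qed.

Let measurable_psi : measurable_fun setT psi.
Proof.
apply: measurable_maxr => //; apply: measurable_funB => //.
apply: measurable_funM => //; apply: continuous_measurable_rV => x.
by apply: (@continuous_comp _ _ _ (fun y : 'rV[R]_n => y - x0)%R (@Num.norm _
  _)) => /=;
  [apply: continuousB => //; exact: cst_continuous|exact: norm_continuous].
Qed.

Let psi_lip x z : (`|x - z| <= r)%R -> (psi z <= psi x + r / rho)%R.
Proof.
move=> xz; rewrite ge_max addr_ge0 ?divr_ge0 ?psi_ge0 ?(ltW r0) ?(ltW rho0)//=.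
apply: (@le_trans _ _ (2 - `|x - x0| / rho + r / rho)%R); last first.
  by rewrite lerD2r le_max lexx orbT.
have : (`|x - x0| / rho <= `|z - x0| / rho + r / rho)%R.
  rewrite -mulrDl ler_pM2r ?invr_gt0// [leRHS]addrC.
  by rewrite (le_trans (ler_distD z _ _))// lerD2r.
by move: (_ / _)%R (`|_| / _)%R => a b; lra.
Qed.

Let psi_out x : ~ ball x0 (2 * rho)%R x -> psi x = 0%R.
Proof.
rewrite rV_ballE /= => /negP; rewrite -leNgt distrC => h.
by apply/max_idPl; rewrite subr_le0 ler_pdivlMr.
Qed.

Let psi_le2 x : (psi x <= 2)%R.
Proof. by rewrite ge_max ler0n/= gerBl divr_ge0// ltW. Qed.

Let psi_in x : ball x0 rho x -> (1 <= psi x)%R.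
Proof.
rewrite rV_ballE /= distrC => /ltW h; rewrite le_max; apply/orP; right.
by rewrite lerBrDr -lerBrDl ler_pdivrMr//; lra.
Qed.

(** The sign of [V g - I] removes the absolute value and makes the weighted integral linear in [g].
    The factor [r / rho] bounds the drop of [psi] from the centre of a ball of radius [r]. The three
    radii serve the estimate, the support of [psi], and the balls of radius [r <= rho] centred in
    that support. *)
Lemma mean_deviation (g : 'rV[R]_n -> \bar R) :
  measurable_fun setT g -> (forall x, 0 <= g x) ->
  \int[mu]_(z in ball x0 (3 * rho)%R) g z < +oo ->
  {ae mu, forall x, ball x0 (2 * rho)%R x ->
    \int[mu]_(z in euclidean_ball x r) g z <= V%:E * g x} ->
  \int[mu]_(x in ball x0 rho)
     `|V%:E * g x - \int[mu]_(z in euclidean_ball x r) g z| <=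
  (V * (r / rho))%:E * \int[mu]_(z in ball x0 (3 * rho)%R) g z.
Proof.
move=> mg g0 gfin Hae.
set I := fun x => \int[mu]_(z in euclidean_ball x r) g z.
set S := ball x0 (3 * rho)%R in gfin *.
have mS : measurable S by exact: measurable_rV_ball.
have V0 := euclidean_ball_volume_gt0 n r0.
have I0 x : 0 <= I x by apply: integral_ge0.
have mI : measurable_fun setT I by exact: measurable_ball_integral.
have Ifin x : ball x0 (2 * rho)%R x -> I x < +oo.
  move=> xb; apply: subset_integral_fin gfin => //;
    first exact: measurable_euclidean_ball.
  move=> z /(norm_le_sqd (ltW r0)) h; move: xb; rewrite /S !rV_ballE /= => xb.
  by rewrite (le_lt_trans (ler_distD x _ _))// (lt_le_trans (ltr_leD xb h)
    rho23).
have mpsi : measurable_fun setT (EFin \o psi) by exact/measurable_EFinP.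
have E1 : \int[mu]_x ((psi x)%:E * I x) =
    \int[mu]_z (g z * \int[mu]_(x in euclidean_ball z r) (psi x)%:E).
  rewrite /I; under eq_integral do rewrite euclidean_ballE.
  under [RHS]eq_integral do rewrite euclidean_ballE.
  by rewrite sqd_tonelli// => x; rewrite lee_fin.
have {}Hae : {ae mu, forall x, ball x0 (2 * rho)%R x -> I x <=
  V%:E * g x} := Hae.
rewrite -[leLHS]/(\int[mu]_(x in ball x0 rho) `|V%:E * g x - I x|).
clearbody I.
pose W x := `|V%:E * g x - I x|.
have mVg : measurable_fun setT (fun x => V%:E * g x) by exact: measurable_funeM.
have mW : measurable_fun setT W.
  by apply: measurableT_comp => //; exact: emeasurable_funB.
(* On the ball around [z], [psi z <= psi x + r / rho]; integrate in [x] and multiply by [g z].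
   Outside [S] the left side is 0. *)
have E2 : \int[mu]_z (g z * (V * psi z)%:E) <=
    \int[mu]_x ((psi x)%:E * I x) + (V * (r / rho))%:E * \int[mu]_(z in S) g z.
  rewrite E1 -ge0_integralZl//; last 2 first.
  - exact: measurable_funTS.
  - by rewrite lee_fin !mulr_ge0 ?invr_ge0// ltW.
  rewrite [X in _ <= _ + X]integral_mkcond -ge0_integralD//; last 4 first.
  - by move=> x _; rewrite mule_ge0// integral_ge0// => y _;
      rewrite lee_fin psi_ge0.
  - by apply: emeasurable_funM => //; exact: measurable_ball_integral.
  - move=> x _; rewrite patchE; case: ifPn => // _.
    by rewrite mule_ge0// lee_fin !mulr_ge0 ?invr_ge0// ltW.
  - by apply/(measurable_restrictT _ mS)/measurable_funTS;
      exact: measurable_funeM.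
  apply: ge0_le_integral => //.
  - by move=> z _; rewrite mule_ge0// lee_fin mulr_ge0// ltW.
  - by apply: emeasurable_funM => //; apply/measurable_EFinP;
      exact: measurable_funM.
  - apply: emeasurable_funD.
      by apply: emeasurable_funM => //; exact: measurable_ball_integral.
    by apply/(measurable_restrictT _ mS)/measurable_funTS;
      exact: measurable_funeM.
  move=> z _; rewrite patchE; case: ifPn => [/set_mem zS|/negP zS]; last first.
    rewrite psi_out ?mulr0 ?mule0 ?adde0.
      by rewrite mule_ge0// integral_ge0// => y _; rewrite lee_fin.
    move=> h; apply: zS; apply/mem_set; move: h; apply: rV_ball_sub.
    by exact: rho_le.
  rewrite [X in _ + X]muleC -ge0_muleDr//; last 2 first.
  - by apply: integral_ge0 => y _; rewrite lee_fin.
  - by rewrite lee_fin !mulr_ge0 ?invr_ge0// ltW.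
  apply: lee_wpmul2l => //.
  have mB := measurable_euclidean_ball z r.
  have cstB (c : R) : \int[mu]_(x in euclidean_ball z r) c%:E = (V * c)%:E.
    rewrite integral_cst//;
      rewrite [X in _ * X](lebesgue_euclidean_ball z (ltW r0)).
    by rewrite -EFinM mulrC.
  have mpsiB : measurable_fun (euclidean_ball z r) (fun x => (psi x)%:E).
    exact: measurable_funTS.
  have rrho0 : 0 <= (r / rho)%:E by rewrite lee_fin divr_ge0// ltW.
  have psi0E x : 0 <= (psi x)%:E by rewrite lee_fin.
  rewrite -!cstB -ge0_integralD//.
  apply: ge0_le_integral => //.
  - exact: emeasurable_funD.
  move=> x /(norm_le_sqd (ltW r0)) zx; rewrite -EFinD lee_fin psi_lip//.
  by rewrite distrC.
(* Integrates [V g = |V g - I| + I] against [psi]; the identity is known a.e. where [psi] may be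
   nonzero. *)
have E3 : \int[mu]_z (g z * (V * psi z)%:E) =
    \int[mu]_x ((psi x)%:E * W x) + \int[mu]_x ((psi x)%:E * I x).
  rewrite -ge0_integralD//; last 4 first.
  - by move=> x _; rewrite mule_ge0// ?lee_fin// abse_ge0.
  - exact: emeasurable_funM.
  - by move=> x _; rewrite mule_ge0// lee_fin.
  - exact: emeasurable_funM.
  apply: ge0_ae_eq_integral => //.
  - by apply: emeasurable_funM => //; apply/measurable_EFinP;
      exact: measurable_funM.
  - by apply: emeasurable_funD; exact: emeasurable_funM.
  - by move=> x _; rewrite mule_ge0// lee_fin mulr_ge0// ltW.
  - by move=> x _; rewrite adde_ge0// mule_ge0// ?lee_fin// abse_ge0.
  apply: filterS Hae => x Hx _.
  have [xb|xb] := pselect (ball x0 (2 * rho)%R x); last first.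
    by rewrite psi_out// mulr0 mule0 !mul0e adde0.
  have /Ifin Ix := xb; have {}Hx := Hx xb.
  have If : I x \is a fin_num by rewrite ge0_fin_numE.
  have VI : 0 <= V%:E * g x - I x by rewrite sube_ge0// If.
  rewrite /W gee0_abs// -ge0_muleDr// subeK// EFinM muleA (muleC (g x)) -muleA.
  by rewrite (muleC (g x)) muleCA.
(* The term common to [E2] and [E3] must be finite before it can be cancelled. *)
have E4 : \int[mu]_x ((psi x)%:E * I x) < +oo.
  apply: (@le_lt_trans _ _ (\int[mu]_z (g z * (V * psi z)%:E))).
    by rewrite E3 leeDr// integral_ge0// => x _;
      rewrite mule_ge0// ?lee_fin// abse_ge0.
  apply: (@le_lt_trans _ _ (\int[mu]_(z in S) ((2 * V)%:E * g z))); last first.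
    rewrite ge0_integralZl//;
      [|exact: measurable_funTS|by rewrite lee_fin mulr_ge0// ltW].
    by rewrite lte_mul_pinfty// lee_fin mulr_ge0// ltW.
  rewrite [leRHS]integral_mkcond; apply: ge0_le_integral => //.
  - by move=> x _; rewrite mule_ge0// lee_fin mulr_ge0// ltW.
  - by apply: emeasurable_funM => //; apply/measurable_EFinP;
      exact: measurable_funM.
  - by apply/(measurable_restrictT _ mS)/measurable_funTS;
      exact: measurable_funeM.
  move=> z _; rewrite patchE; case: ifPn => [/set_mem zS|/negP zS]; last first.
    rewrite psi_out ?mulr0 ?mule0// => h; apply: zS; apply/mem_set; move: h.
    by apply: rV_ball_sub; exact: rho_le.
  rewrite muleC lee_wpmul2r// lee_fin mulrC.
  by rewrite ler_pM2r.
have E5 : \int[mu]_x ((psi x)%:E * W x) <= (V * (r / rho))%:E * \int[mu]_(z in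
  S) g z.
  rewrite -(@leeD2rE _ (\int[mu]_x ((psi x)%:E * I x))); last first.
    by rewrite ge0_fin_numE// integral_ge0// => x _; rewrite mule_ge0// lee_fin.
  by rewrite -E3 [leRHS]addeC.
apply: le_trans E5; rewrite integral_mkcond; apply: ge0_le_integral => //.
- by move=> x _; rewrite patchE; case: ifPn => // _; exact: abse_ge0.
- apply/(measurable_restrictT _ (measurable_rV_ball _ _)).
  exact: measurable_funTS.
- exact: emeasurable_funM.
move=> x _; rewrite patchE; case: ifPn => [/set_mem xb|_].
  by rewrite -[leLHS]mul1e lee_wpmul2r ?abse_ge0// lee_fin psi_in.
by rewrite mule_ge0// ?lee_fin// abse_ge0.
Qed.

End mean_deviation.

(** * Dependence of the means on the centre *)

Section annulus.
Context {R : realType}.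
Local Open Scope ereal_scope.

(* Measured in squared distance, so that [sqd_perturb] replaces the triangle
   inequality of the Euclidean norm. *)
Definition sqd_annulus n (x : 'rV[R]_n) (r t : R) : set 'rV[R]_n :=
  sqd x @^-1` `[(r ^+ 2 - t)%R, (r ^+ 2 + t)%R]%classic.

Lemma measurable_sqd_annulus n (x : 'rV[R]_n) r t :
  measurable (sqd_annulus x r t).
Proof. exact: measurable_sqd_set. Qed.

(** Continuity from above: the annuli decrease to a sphere, which is null. *)
Lemma sqd_annulus_cvg n r :
  lebesgue_rV n.+1 (sqd_annulus 0%R r k.+1%:R^-1) @[k --> \oo] --> (0 : \bar R).
Proof.
have -> : (0 : \bar R) = lebesgue_rV n.+1
    (\bigcap_k (sqd_annulus (0%R : 'rV[R]_n.+1) r k.+1%:R^-1)).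
  rewrite (_ : \bigcap_k _ = sqd 0%R @^-1` [set (r ^+ 2)%R]).
    by rewrite lebesgue_rV_sphere.
  apply/seteqP; split => [y h|y /= h k _]; last first.
    by rewrite /sqd_annulus/= in_itv/= h gerBl lerDl invr_ge0 ler0n.
  have {}h k : (`|sqd 0 y - r ^+ 2| <= k.+1%:R^-1)%R.
    by have := h k I; rewrite /sqd_annulus/= in_itv/= ler_distl.
  apply/eqP; rewrite -subr_eq0 -normr_le0; apply/ler_addgt0Pl => e e0.
  have [k] := ltr_add_invr e0; rewrite add0r => /ltW ke.
  by rewrite addr0 (le_trans (h k)).
apply: nonincreasing_cvg_mu => //.
(* The first annulus has finite measure, because [r^2 + 1 <= (|r| + 1)^2]. *)
- apply: (@lebesgue_rV_bounded _ _ 0%R (`|r| + 2)%R).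
    exact: measurable_sqd_annulus.
  have -> : (ball (0 : 'rV[R]_n.+1) (`|r| + 2) = ball 0 ((`|r| + 1) + 1))%R.
    by rewrite -addrA.
  apply: (@subset_trans _ (euclidean_ball 0%R (`|r| + 1)%R)); last first.
    apply: (@subset_euclidean_ball _ _ _ _ _ 0%R) => //.
      by rewrite subrr normr0.
    by rewrite addr0 ltrDl.
  move=> y; rewrite /sqd_annulus/= in_itv/= => /andP[_].
  move=> h; apply: (le_trans h); rewrite invr1 sqrrD1 real_normK ?num_real//.
  by rewrite -addrA lerD2l lerDr mulrn_wge0.
- by move=> k; exact: measurable_sqd_annulus.
- by apply: bigcapT_measurable => k; exact: measurable_sqd_annulus.
- move=> i j ij; apply/subsetPset => y; rewrite /sqd_annulus/= !in_itv/=.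
  have h : (j.+1%:R^-1 <= i.+1%:R^-1 :> R)%R by rewrite lef_pV2 ?posrE//
    ler_nat.
  by move=> /andP[h1 h2]; rewrite (le_trans _ h1) ?lerB// (le_trans h2)// lerD.
Qed.

Lemma sqd_annulus_small n r (c e : R) : (0 < c)%R -> (0 < e)%R ->
  exists t : R, [/\ (0 < t)%R, (t <= c)%R &
    lebesgue_rV n.+1 (sqd_annulus 0%R r t) <= e%:E].
Proof.
move=> c0 e0.
have [k ke] : exists k, lebesgue_rV n.+1 (sqd_annulus 0%R r k.+1%:R^-1) < e%:E
  /\ (k.+1%:R^-1 <= c)%R.
  have H1 : \forall k \near \oo, lebesgue_rV n.+1 (sqd_annulus 0%R r
    k.+1%:R^-1) < e%:E.
    have H := sqd_annulus_cvg n r.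
    apply: (H [set x | x < e%:E]).
    by apply: open_ereal_lt'; rewrite lte_fin.
  have H2 : \forall k \near \oo, (k.+1%:R^-1 <= c)%R.
    have := @near_infty_natSinv_lt R (PosNum c0); apply: filterS => k /ltW //.
  by have [k _ h] := filterI H1 H2; exists k; exact: (h k (leqnn k)).
by exists (k.+1%:R^-1)%R; split; [|case: ke|apply: ltW; case: ke].
Qed.

End annulus.

Section mean_modulus.
Context {R : realType}.
Variables (n : nat) (x0 : 'rV[R]_n) (rho r t d : R).
Notation mu := (lebesgue_rV n).
Local Open Scope ereal_scope.
Hypotheses (r0 : (0 < r)%R) (rrho : (r <= rho)%R).
Hypotheses (trho : (t <= rho ^+ 2)%R).
Hypotheses (d0 : (0 <= d)%R) (dt : (n%:R * (2 * r * d + d ^+ 2) <= t)%R).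
Variables (g g' : 'rV[R]_n -> R).
Hypotheses (mg : measurable_fun setT g) (mg' : measurable_fun setT g').
Hypotheses (g0 : forall x, (0 <= g x)%R) (g'0 : forall x, (0 <= g' x)%R).
Let S := ball x0 (3 * rho)%R.
Hypotheses (gS : \int[mu]_(z in S) (g z)%:E < +oo).
Hypotheses (g'S : \int[mu]_(z in S) (g' z)%:E < +oo).

Let rho0 : (0 < rho)%R. Proof. exact: lt_le_trans rrho. Qed.

Let mS : measurable S. Proof. exact: measurable_rV_ball. Qed.

Let rho23 : (2 * rho + rho <= 3 * rho)%R. Proof. lra. Qed.

Let I (f : 'rV[R]_n -> R) x := \int[mu]_(z in euclidean_ball x r) (f z)%:E.

Let ballS x y c : (`|x - x0| <= rho)%R -> (`|x - y| <= c)%R ->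
  (c < 2 * rho)%R -> S y.
Proof.
rewrite distrC => xb xy c2.
rewrite /S rV_ballE /= (le_lt_trans (ler_distD x _ _))//.
by rewrite (lt_le_trans _ rho23)// addrC ltr_leD// (le_lt_trans xy).
Qed.

Let integrable_ball (f : 'rV[R]_n -> R) x : measurable_fun setT f ->
  (forall x, (0 <= f x)%R) -> \int[mu]_(z in S) (f z)%:E < +oo ->
  (`|x - x0| <= rho)%R -> mu.-integrable (euclidean_ball x r) (EFin \o f).
Proof.
move=> mf f0 fS xb; apply: (@integrableS _ _ _ _ S) => //.
- exact: measurable_euclidean_ball.
- move=> z /(norm_le_sqd (ltW r0)) h; apply: (ballS xb h).
  by rewrite (le_lt_trans rrho)// ltr_pMl// ltr1n.
- apply/integrableP; split; first by apply/measurable_EFinP;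
    exact: measurable_funTS.
  by under eq_integral do rewrite /= ger0_norm//.
Qed.

(** The integrals of [g - g'] over the balls around [x] and [p] differ only by the symmetric
    difference of the balls. By [sqd_perturb] with [M = r], hypothesis [dt] places that set in the
    annulus of half-width [t] around [x]. *)
Lemma mean_modulus_pointwise x p :
  (`|x - x0| <= rho)%R -> (`|p - x0| <= rho)%R -> (`|x - p| <= d)%R ->
  `|I g x - I g' x| <= `|I g p - I g' p| +
    \int[mu]_(z in sqd_annulus x r t) `|g z - g' z|%:E.
Proof.
move=> xb pb xp.
pose h z := (g z - g' z)%R.
have mh : measurable_fun setT h by exact: measurable_funB.
have Ih y : (`|y - x0| <= rho)%R ->
    mu.-integrable (euclidean_ball y r) (EFin \o h) /\
    I g y - I g' y = \int[mu]_(z in euclidean_ball y r) (EFin \o h) z.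
  move=> yb; have ig := integrable_ball mg g0 gS yb.
  have ig' := integrable_ball mg' g'0 g'S yb.
  split; last by rewrite /I -integralB_EFin//; exact: measurable_euclidean_ball.
  rewrite (_ : _ \o _ = (EFin \o g) \- (EFin \o g'))//.
  by apply: integrableB => //; exact: measurable_euclidean_ball.
have [ihx ->] := Ih _ xb; have [ihp ->] := Ih _ pb.
have mB y : measurable (euclidean_ball y r) by exact: measurable_euclidean_ball.
rewrite [X in `|X| <= _]integral_mkcond [X in _ <= `|X| + _]integral_mkcond.
set a := (EFin \o h) \_ (euclidean_ball x r).
set b := (EFin \o h) \_ (euclidean_ball p r).
have ia : mu.-integrable setT a by apply/(integrable_mkcond _ (mB _ x));
  exact: ihx.
have ib : mu.-integrable setT b by apply/(integrable_mkcond _ (mB _ p));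
  exact: ihp.
have -> : \int[mu]_z a z = \int[mu]_z b z + \int[mu]_z (a \- b) z.
  rewrite integralB// addeC subeK//; exact: integrable_fin_num.
apply: le_trans (lee_abs_add _ _) _; rewrite leeD2l//.
apply: le_trans (le_abse_integral _ _ _) _ => //.
  by apply: emeasurable_funB;
    [move/integrableP : ia => []|move/integrableP: ib => []].
rewrite [leRHS]integral_mkcond; apply: ge0_le_integral => //.
- apply: measurableT_comp => //.
  by apply: emeasurable_funB;
    [move/integrableP : ia => []|move/integrableP: ib => []].
- apply/(measurable_restrictT _ (measurable_sqd_annulus _ _ _)).
  by apply: measurable_funTS; apply/measurable_EFinP; exact: measurableT_comp.
have pT (A : set 'rV[R]_n) z : A z -> ((EFin \o h) \_ A) z = (h z)%:E.
  by move=> Az; rewrite patchE mem_set.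
have pN (A : set 'rV[R]_n) z : ~ A z -> ((EFin \o h) \_ A) z = 0.
  by move=> Az; rewrite patchE memNset.
have c0 z : 0 <= ((fun z => `|g z - g' z|%:E) \_ (sqd_annulus x r t)) z.
  by rewrite patchE; case: ifPn => // _; rewrite lee_fin.
move=> z _; have [zx|zx] := pselect (euclidean_ball x r z);
  have [zp|zp] := pselect (euclidean_ball p r z).
- by rewrite /a /b !pT// subee// abse0.
- rewrite /a /b pT// pN// sube0 patchE mem_set//=.
  have := norm_le_sqd (ltW r0) zx => /sqd_perturb /(_ xp) /le_trans /(_ dt).
  move: zx zp; rewrite /euclidean_ball/= -!/(sqd _ _) => zx /negP.
  rewrite -ltNge => zp; rewrite ler_distl => /andP[u v].
  by rewrite /sqd_annulus/= in_itv/=; apply/andP; split; lra.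
- rewrite /a /b pN// pT// sub0e abseN patchE mem_set//=.
  have px : (`|p - x| <= d)%R by rewrite distrC.
  have := norm_le_sqd (ltW r0) zp => /sqd_perturb /(_ px) /le_trans /(_ dt).
  move: zx zp; rewrite /euclidean_ball/= -!/(sqd _ _) => /negP.
  rewrite -ltNge => zx zp; rewrite ler_distl => /andP[u v].
  by rewrite /sqd_annulus/= in_itv/=; apply/andP; split; lra.
- by rewrite /a /b !pN// sube0 abse0.
Qed.

(** Each [x] is compared with a point of [P] at distance less than [d]. Tonelli then moves the
    annulus onto [x], where it contributes at most its measure, the same for every centre. *)
Lemma mean_modulus (P : set 'rV[R]_n) (k : R) : (0 <= k)%R ->
  ball x0 rho `<=` \bigcup_(p in P) ball p d ->
  (forall p, P p -> (`|p - x0| <= rho)%R /\ `|I g p - I g' p| <= k%:E) ->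
  \int[mu]_(x in ball x0 rho) `|I g x - I g' x| <=
  k%:E * mu (ball x0 rho) +
  mu (sqd_annulus 0%R r t) * \int[mu]_(z in S) `|g z - g' z|%:E.
Proof.
move=> k0 cov HP.
(* Both domains of integration are absorbed into the integrands, as [sqd_tonelli] integrates over
   the whole space. *)
pose a (x : 'rV[R]_n) := (\1_(ball x0 rho) x)%:E : \bar R.
pose h z := `|g z - g' z|%:E.
pose b := h \_ S.
have mB : measurable (ball x0 rho) by exact: measurable_rV_ball.
have mh : measurable_fun setT h.
  by apply/measurable_EFinP; apply: measurableT_comp => //;
    exact: measurable_funB.
have mb : measurable_fun setT b.
  by apply/(measurable_restrictT _ mS); exact: measurable_funTS.
have h0 z : 0 <= h z by rewrite lee_fin.
have b0 z : 0 <= b z by rewrite /b patchE; case: ifPn.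
have a0 z : 0 <= a z by rewrite lee_fin.
have ma : measurable_fun setT a by apply/measurable_EFinP.
have mI (f : 'rV[R]_n -> R) : measurable_fun setT f -> (forall y, (0 <=
  f y)%R) -> measurable_fun setT (I f).
  move=> mf f0; apply: measurable_ball_integral.
    exact/measurable_EFinP.
  by move=> x; rewrite lee_fin.
pose J x := \int[mu]_(z in sqd_annulus x r t) b z.
have mJ : measurable_fun setT J by exact: measurable_sqd_integral.
have J0 x : 0 <= J x by apply: integral_ge0.
have H1 : \int[mu]_(x in ball x0 rho) `|I g x - I g' x| <=
    \int[mu]_(x in ball x0 rho) (k%:E + J x).
  apply: ge0_le_integral => //.
  - apply: measurable_funTS; apply: measurableT_comp => //.
    by apply: emeasurable_funB; exact: mI.
  - by apply: measurable_funTS; exact: emeasurable_funD.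
  move=> x xb; have [p Pp xp] := cov x xb.
  have [pb pk] := HP p Pp.
  move: (xb) (xp); rewrite !rV_ballE /= ![(`|_ - x|)%R]distrC =>
    /ltW xb' /ltW xp'.
  apply: le_trans (mean_modulus_pointwise xb' pb xp') _.
  rewrite leeD//; rewrite /J [leRHS]integral_mkcond [leLHS]integral_mkcond.
  apply: ge0_le_integral => //.
  - by move=> z _; rewrite patchE; case: ifPn => // _; rewrite lee_fin.
  - apply/(measurable_restrictT _ (measurable_sqd_annulus _ _ _)).
    exact: measurable_funTS.
  - apply/(measurable_restrictT _ (measurable_sqd_annulus _ _ _)).
    exact: measurable_funTS.
  move=> z _; rewrite !patchE; case: ifPn => // /set_mem zA.
  rewrite /b patchE mem_set//.
  move: zA; rewrite /sqd_annulus/= in_itv/= => /andP[_ zA].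
  (* The outer radius of the annulus: [c^2 <= 2 rho^2 < (2 rho)^2], so annuli centred in the closed
     ball of radius [rho] stay in [S]. *)
  pose c := Num.sqrt (r ^+ 2 + t)%R.
  have t0 : (0 <= t)%R.
    apply: le_trans dt; rewrite mulr_ge0// addr_ge0 ?sqr_ge0// mulr_ge0//
      mulr_ge0//.
    exact: ltW.
  have rt0 : (0 <= r ^+ 2 + t)%R by rewrite addr_ge0// sqr_ge0.
  apply: (@ballS x z c) => //.
    by apply: norm_le_sqd; [exact: sqrtr_ge0|rewrite sqr_sqrtr].
  rewrite -(@ltr_pXn2r _ 2)// ?nnegrE ?sqrtr_ge0// ?mulr_ge0// ?(ltW rho0)//.
  rewrite sqr_sqrtr// exprMn (@le_lt_trans _ _ (rho ^+ 2 + rho ^+ 2)%R)//.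
    by rewrite lerD// ler_pXn2r// nnegrE ltW.
  have : (0 < rho ^+ 2)%R by rewrite exprn_gt0.
  lra.
apply: le_trans H1 _; rewrite ge0_integralD//; last exact: measurable_funTS.
rewrite integral_cst// leeD//.
have -> : \int[mu]_(x in ball x0 rho) J x = \int[mu]_x (a x * J x).
  rewrite integral_mkcond; apply: eq_integral => x _; rewrite patchE /a indicE.
  by case: ifPn => _; rewrite ?mul1e ?mul0e.
rewrite /J sqd_tonelli//.
rewrite [X in _ <= _ * X]integral_mkcond -/h -/b.
rewrite -ge0_integralZl//.
apply: ge0_le_integral => //.
- by move=> z _; rewrite mule_ge0// integral_ge0.
- by apply: emeasurable_funM => //; exact: measurable_sqd_integral.
- exact: measurable_funeM.
move=> z _; rewrite muleC lee_wpmul2r//.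
have -> : mu (sqd_annulus 0%R r t) = mu (sqd_annulus z r t).
  by rewrite [RHS]lebesgue_rV_sqd.
rewrite -[leRHS]mul1e -integral_cst; last exact: measurable_sqd_annulus.
apply: ge0_le_integral => //.
- exact: measurable_sqd_annulus.
- exact: measurable_funTS.
by move=> x _; rewrite /a lee_fin indicE lern1; case: (_ \in _).
Qed.

End mean_modulus.

(** * Local precompactness *)

Section local_precompactness.
Context {R : realType}.
Local Open Scope ereal_scope.

Lemma closed_norm_ball_compact n (x : 'rV[R]_n) (e : R) :
  compact [set y | `|y - x| <= e]%R.
Proof.
apply: bounded_closed_compact.
  exists (`|x| + `|e|)%R; split; first exact: num_real.
  move=> M xeM y /= yx; rewrite -(subrK x y) (le_trans (ler_normD _ _))//.
  by rewrite (le_trans _ (ltW xeM))// addrC lerD2l (le_trans yx)// ler_norm.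
rewrite (_ : [set y | _] = (fun y : 'rV[R]_n => `|y - x|)%R @^-1` [set t | t <=
  e]%R)//.
apply: closed_comp; last exact: closed_le.
move=> y _; apply: (@continuous_comp _ _ _ (fun y : 'rV[R]_n =>
  y - x)%R (@Num.norm _ _)) => /=;
  [apply: continuousB => //; exact: cst_continuous|exact: norm_continuous].
Qed.

Lemma finite_ball_cover n (K : set 'rV[R]_n) (e : 'rV[R]_n -> R) :
  compact K -> (forall x, K x -> (0 < e x)%R) ->
  exists s : seq 'rV[R]_n,
    (forall p, p \in s -> K p) /\ K `<=` \bigcup_(p in [set` s]) ball p (e p).
Proof.
rewrite compact_cover => cK e0.
have [|x Kx|P PK KP] := cK _ K (fun p => ball p (e p)).
- by move=> p _; exact: ball_open.
- by exists x => //; apply: ballxx; exact: e0.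
exists (finmap.enum_fset P); split => [p /PK /set_mem//|x /KP[p pP xp]].
by exists p.
Qed.

(** [r], [k] and [s] are chosen before [g] and [g']: finitely many means test L^1 closeness
    uniformly over the class. The bound, multiplied by [V], splits as [V e / 6] for each deviation,
    [V e / 3] for the values at [s] and [V e / 3] for the annulus, where the L^1 norm of [g - g'] is
    at most [2 C]. The summands 1 in [C + 1] and [m + 1] only keep denominators positive. *)
Lemma local_precompactness n (x0 : 'rV[R]_n.+1) (rho C e : R) :
  (0 < rho)%R -> (0 <= C)%R -> (0 < e)%R ->
  exists (r k : R) (s : seq 'rV[R]_n.+1),
    [/\ (0 < r)%R /\ (r <= rho)%R, (0 < k)%R,
        forall p, p \in s -> (`|p - x0| <= rho)%R &
    forall g g' : 'rV[R]_n.+1 -> R,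
      [/\ measurable_fun setT g, forall x, (0 <= g x)%R,
        \int[lebesgue_rV n.+1]_(z in ball x0 (3 * rho)%R) (g z)%:E <= C%:E &
        {ae lebesgue_rV n.+1, forall x, ball x0 (2 * rho)%R x ->
         \int[lebesgue_rV n.+1]_(z in euclidean_ball x r) (g z)%:E <=
         (euclidean_ball_volume n.+1 r)%:E * (g x)%:E}] ->
      [/\ measurable_fun setT g', forall x, (0 <= g' x)%R,
        \int[lebesgue_rV n.+1]_(z in ball x0 (3 * rho)%R) (g' z)%:E <= C%:E &
        {ae lebesgue_rV n.+1, forall x, ball x0 (2 * rho)%R x ->
         \int[lebesgue_rV n.+1]_(z in euclidean_ball x r) (g' z)%:E <=
         (euclidean_ball_volume n.+1 r)%:E * (g' x)%:E}] ->
      (forall p, p \in s ->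
        `|\int[lebesgue_rV n.+1]_(z in euclidean_ball p r) (g z)%:E -
          \int[lebesgue_rV n.+1]_(z in euclidean_ball p r) (g' z)%:E| <=
            k%:E) ->
      \int[lebesgue_rV n.+1]_(x in ball x0 rho) `|g x - g' x|%:E <= e%:E].
Proof.
move=> rho0 C0 e0.
set mu := lebesgue_rV n.+1.
pose q := Num.min 1%R (e / (6 * (C + 1)))%R.
have C1 : (0 < C + 1)%R by lra.
have q0 : (0 < q)%R by rewrite lt_min ltr01/= divr_gt0// mulr_gt0.
have qC : (q * C <= e / 6)%R.
  have : (q <= e / (6 * (C + 1)))%R by rewrite ge_min lexx orbT.
  rewrite ler_pdivlMr ?mulr_gt0// => H.
  have : (0 <= q)%R by exact: ltW.
  by move: H; nra.
pose r := (rho * q)%R.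
have r0 : (0 < r)%R by rewrite mulr_gt0.
have rrho : (r <= rho)%R by rewrite ger_pMr// ge_min lexx.
have rq : (r / rho = q)%R by rewrite /r mulrAC divff ?mul1r// gt_eqF.
pose V := euclidean_ball_volume n.+1 r.
have V0 : (0 < V)%R := euclidean_ball_volume_gt0 _ r0.
have [t [t0 trho Tt]] := @sqd_annulus_small R n r (rho ^+
  2)%R (V * e / (6 * (C + 1)))%R
  (exprn_gt0 _ rho0) (divr_gt0 (mulr_gt0 V0 e0) (mulr_gt0 (ltr0Sn _ 5) C1)).
have r21 : (0 < 2 * r + 1)%R by lra.
(* With [d <= 1], [d^2 <= d], so that [2 r d + d^2 <= (2 r + 1) d]. *)
pose d := Num.min 1%R (t / (n.+1%:R * (2 * r + 1)))%R.
have d0 : (0 < d)%R by rewrite lt_min ltr01/= divr_gt0// mulr_gt0.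
have dt : (n.+1%:R * (2 * r * d + d ^+ 2) <= t)%R.
  have : (d <= t / (n.+1%:R * (2 * r + 1)))%R by rewrite ge_min lexx orbT.
  rewrite ler_pdivlMr ?mulr_gt0// => H; apply: le_trans H.
  rewrite [leRHS]mulrCA ler_pM2l// expr2 -mulrDl mulrC ler_pM2l// lerD2l.
  by rewrite ge_min lexx.
have mfin := lebesgue_rV_ball_fin x0 rho.
pose m := fine (mu (ball x0 rho)).
have mE : mu (ball x0 rho) = m%:E by rewrite fineK// ge0_fin_numE.
have m0 : (0 <= m)%R by rewrite fine_ge0.
pose k := (V * e / (3 * (m + 1)))%R.
have k0 : (0 < k)%R by rewrite divr_gt0 ?mulr_gt0// ltr_pwDr.
have km : (k * m <= V * e / 3)%R.
  rewrite /k invfM !mulrA -[leRHS]mulr1 -mulrA ler_pM2l ?divr_gt0 ?mulr_gt0//.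
  by rewrite mulrC ler_pdivrMr ?mul1r ?ltr_pwDr// lerDl.
have [P [PK KP]] := finite_ball_cover (e := fun=> d)
  (closed_norm_ball_compact (x := x0) (e := rho)) (fun _ _ => d0).
exists r, k, P; split => // g g' [mg g0 gC gae] [mg' g'0 g'C g'ae] HP.
have gfin : \int[mu]_(z in ball x0 (3 * rho)%R) (g z)%:E < +oo.
  exact: le_lt_trans gC (ltry _).
have g'fin : \int[mu]_(z in ball x0 (3 * rho)%R) (g' z)%:E < +oo.
  exact: le_lt_trans g'C (ltry _).
have mgE : measurable_fun setT (EFin \o g) by exact/measurable_EFinP.
have mgE' : measurable_fun setT (EFin \o g') by exact/measurable_EFinP.
have gE0 x : 0 <= (EFin \o g) x by rewrite lee_fin.
have gE0' x : 0 <= (EFin \o g') x by rewrite lee_fin.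
have A1 := mean_deviation r0 rrho mgE gE0 gfin gae.
have A2 := mean_deviation r0 rrho mgE' gE0' g'fin g'ae.
have B := mean_modulus r0 rrho trho (ltW d0) dt mg mg' g0 g'0 gfin g'fin (ltW
  k0).
have {}B := B [set` P].
pose I (f : 'rV[R]_n.+1 -> R) x := \int[mu]_(z in euclidean_ball x r) (EFin \o
  f) z.
have mI (f : 'rV[R]_n.+1 -> R) : measurable_fun setT (EFin \o f) ->
    (forall x, 0 <= (EFin \o f) x) -> measurable_fun setT (I f).
  exact: measurable_ball_integral.
have mS : measurable (ball x0 (3 * rho)%R) by exact: measurable_rV_ball.
have mb : measurable (ball x0 rho) by exact: measurable_rV_ball.
have Ifin (f : 'rV[R]_n.+1 -> R) x : measurable_fun setT (EFin \o f) ->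
    (forall x, 0 <= (EFin \o f) x) ->
    \int[mu]_(z in ball x0 (3 * rho)%R) (f z)%:E < +oo ->
    ball x0 rho x -> I f x \is a fin_num.
  move=> mf f0 ffin xb; rewrite ge0_fin_numE; last by apply: integral_ge0.
  apply: subset_integral_fin ffin => //; first exact: measurable_euclidean_ball.
  apply: subset_euclidean_ball; [exact: ltW|move: xb; rewrite rV_ballE;
    exact: ltW|].
  by move: rrho rho0; clear; lra.
have mdev (f : 'rV[R]_n.+1 -> R) : measurable_fun setT (EFin \o f) ->
    (forall x, 0 <= (EFin \o f) x) ->
    measurable_fun setT (fun x => `|V%:E * (f x)%:E - I f x|).
  move=> mf f0; apply: measurableT_comp => //.
  by apply: emeasurable_funB; [exact: measurable_funeM|exact: mI].
have mIgg : measurable_fun setT (fun x => `|I g x - I g' x|).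
  by apply: measurableT_comp => //; apply: emeasurable_funB; exact: mI.
have D0 : \int[mu]_(x in ball x0 rho) (V%:E * `|g x - g' x|%:E) <=
    \int[mu]_(x in ball x0 rho)
      (`|V%:E * (g x)%:E - I g x| + `|I g x - I g' x| +
        `|V%:E * (g' x)%:E - I g' x|).
  apply: ge0_le_integral => //.
  - by move=> x _; rewrite mule_ge0// lee_fin// ltW.
  - apply: measurable_funTS; apply: measurable_funeM; apply/measurable_EFinP.
    by apply: measurableT_comp => //; exact: measurable_funB.
  - apply: measurable_funTS; apply: emeasurable_funD; last exact: mdev.
    by apply: emeasurable_funD => //; exact: mdev.
  move=> x xb.
  have := Ifin g x mgE gE0 gfin xb; have := Ifin g' x mgE' gE0' g'fin xb.
  case: (I g' x) => [b| |]//; case: (I g x) => [a| |]// _ _.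
  rewrite -!EFinM -!EFinB !abse_EFin -!EFinD lee_fin.
  have -> : (V * `|g x - g' x| =
      `|(V * g x - a) + (a - b) - (V * g' x - b)|)%R.
    by rewrite -{1}(gtr0_norm V0) -normrM; congr (`|_|)%R; ring.
  by rewrite (le_trans (ler_normB _ _))// lerD2r ler_normD.
have mgg : measurable_fun (ball x0 rho) (fun x => `|g x - g' x|%:E).
  apply: measurable_funTS; apply/measurable_EFinP.
  by apply: measurableT_comp => //; exact: measurable_funB.
have gg0 x : 0 <= `|g x - g' x|%:E by rewrite lee_fin.
have VE0 : 0 <= V%:E by rewrite lee_fin ltW.
rewrite ge0_integralZl// in D0.
rewrite -(@lee_pmul2l _ V%:E)//.
apply: le_trans D0 _.
have m1 := measurable_funTS (D := ball x0 rho) (mdev g mgE gE0).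
have m2 := measurable_funTS (D := ball x0 rho) (mdev g' mgE' gE0').
have m3 := measurable_funTS (D := ball x0 rho) mIgg.
have n1 x : 0 <= `|V%:E * (g x)%:E - I g x| by exact: abse_ge0.
have n2 x : 0 <= `|V%:E * (g' x)%:E - I g' x| by exact: abse_ge0.
have n3 x : 0 <= `|I g x - I g' x| by exact: abse_ge0.
have n13 x : 0 <= `|V%:E * (g x)%:E - I g x| + `|I g x - I g' x| by exact:
  adde_ge0.
have m13 := emeasurable_funD m1 m3.
rewrite ge0_integralD// ge0_integralD//.
have H1 (f : 'rV[R]_n.+1 -> R) :
    \int[mu]_(z in ball x0 (3 * rho)%R) (f z)%:E <= C%:E ->
    (V * (r / rho))%:E * \int[mu]_(z in ball x0 (3 * rho)%R) (f z)%:E <=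
    (V * e / 6)%:E.
  move=> fC; apply: (@le_trans _ _ ((V * (r / rho))%:E * C%:E)).
    by rewrite lee_wpmul2l// lee_fin mulr_ge0 ?divr_ge0 ?ltW.
  rewrite -EFinM lee_fin rq -!mulrA ler_pM2l//.
have H2 : \int[mu]_(x in ball x0 rho) `|I g x - I g' x| <=
    (V * e / 3 + V * e / 3)%:E.
  apply: le_trans (B _ _) _.
  - by move=> y; rewrite rV_ballE /= distrC => /ltW yb; exact: KP.
  - by move=> p Pp; split; [exact: PK|exact: HP].
  rewrite mE EFinD leeD//.
  apply: (@le_trans _ _ ((V * e / (6 * (C + 1)))%:E * (C + C)%:E)).
    apply: lee_pmul => //; first by apply: integral_ge0.
    apply: (@le_trans _ _ (\int[mu]_(z in ball x0 (3 * rho)%R) ((g z)%:E +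
      (g' z)%:E))).
      apply: ge0_le_integral => //.
      - apply: measurable_funTS; apply/measurable_EFinP.
        by apply: measurableT_comp => //; exact: measurable_funB.
      - by apply: measurable_funTS; exact: emeasurable_funD.
      - move=> x _; rewrite -EFinD lee_fin (le_trans (ler_normB _ _))//.
        by rewrite !ger0_norm.
    have mgS : measurable_fun (ball x0 (3 * rho)%R) (fun z => (g z)%:E).
      exact: measurable_funTS.
    have mgS' : measurable_fun (ball x0 (3 * rho)%R) (fun z => (g' z)%:E).
      exact: measurable_funTS.
    by rewrite ge0_integralD// ?EFinD ?leeD// => x _; rewrite lee_fin.
  rewrite -EFinM lee_fin -[leLHS]mulrA ler_pM2l ?mulr_gt0//.
  by rewrite ler_pdivrMl ?mulr_gt0//; move: C0; clear; lra.
apply: (@le_trans _ _ ((V * e / 6)%:E + (V * e / 3 + V * e / 3)%:E +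
  (V * e / 6)%:E)).
  by rewrite !leeD//;
    [exact: le_trans A1 (H1 g gC)|exact: le_trans A2 (H1 g' g'C)].
by rewrite -EFinM -!EFinD lee_fin; clear; lra.
Qed.

End local_precompactness.

(** * Exhaustion of a domain by relatively compact subdomains *)

Section exhaustion.
Context {R : realType} {n : nat}.
Implicit Types (D : set 'rV[R]_n) (x y : 'rV[R]_n).

Lemma rV_ball_connected x (e : R) : connected (ball x e).
Proof.
have [e0|e0] := ltP 0%R e; last first.
  rewrite (_ : ball x e = set0); first exact: connected0.
  by apply/seteqP; split => // y [/lt_le_trans/(_ e0)]; rewrite ltxx.
rewrite (_ : ball x e =
    \bigcup_(y in ball x e) ((fun t : R => x + t *: (y - x)) @` `[0,
      1]%classic)).
  apply: bigcup_connected.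
    exists x => y _; exists 0; last by rewrite scale0r addr0.
    by rewrite /= in_itv/= lexx ler01.
  move=> y _; apply: connected_continuous_connected;
    first exact: segment_connected.
  apply: continuous_subspaceT => t.
  apply: cvgD; first exact: cvg_cst.
  by apply: cvgZr_tmp; exact: cvg_id.
apply/seteqP; split => [y xy|z [y xy] [t /=]].
  exists y => //; exists 1; last by rewrite scale1r addrC subrK.
  by rewrite /= in_itv/= ler01 lexx.
rewrite in_itv/= => /andP[t0 t1] <-.
move: xy; rewrite rV_ballE /= opprD addrA subrr add0r normrN normrZ.
rewrite (ger0_norm t0) (distrC x y) => xy; apply: le_lt_trans xy.
by rewrite ler_piMl.
Qed.

Lemma component_open (A : set 'rV[R]_n) x :
  open A -> open (connected_component A x).
Proof.
rewrite !openE => oA y Ay.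
have /nbhs_ballP[e /= e0 yA] : nbhs y A.
  by apply: oA; exact: (@connected_component_sub _ A x).
apply/nbhs_ballP; exists e => //= z yz.
rewrite (same_connected_component Ay).
apply: (connected_component_max _ yA) yz; first exact: ballxx.
exact: rV_ball_connected.
Qed.

(** The norming condition near the boundary asks for connected sets, so the usual exhaustion is cut
    down to the component of a base point. The union of these components is open and closed in
    [D]. *)
Lemma domain_exhaustion D : domain D -> exists Dj : nat -> set 'rV[R]_n,
  [/\ forall j, domain (Dj j) /\ relatively_compact (Dj j) D,
      forall j, Dj j `<=` Dj j.+1 & \bigcup_j Dj j = D].
Proof.
move=> [[x0 Dx0] oD cD].
(* The slack [e > m.+1%:R^-1] makes [U m] open, while its limit points still have a ball of radius
   [m.+1%:R^-1] inside [D]. *)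
pose U m : set 'rV[R]_n := [set x | `|x| < m.+1%:R /\
  exists2 e : R, m.+1%:R^-1 < e & ball x e `<=` D].
have UD m x : U m x -> D x.
  move=> [_ [e me]]; apply; apply: ballxx; apply: lt_trans me.
  by rewrite invr_gt0.
have oU m : open (U m).
  rewrite openE => x [xm [e me xeD]]; apply/nbhs_ballP.
  exists (Num.min (m.+1%:R - `|x|) ((e - m.+1%:R^-1) / 2)) => /=.
    by rewrite lt_min subr_gt0 xm divr_gt0// subr_gt0.
  move=> y; rewrite rV_ballE /= lt_min => /andP[xy1 xy2]; split.
    rewrite -(subrK x y) (le_lt_trans (ler_normD _ _))// distrC.
    by rewrite -ltrBrDr.
  exists ((e + m.+1%:R^-1) / 2);
    first by rewrite ltr_pdivlMr// mulr_natr mulr2n ltrD2r.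
  move=> z; rewrite rV_ballE /= => yz; apply: xeD; rewrite rV_ballE /=.
  rewrite (le_lt_trans (ler_distD y _ _))//.
  by rewrite (lt_le_trans (ltrD xy2 yz))// -mulrDl addrACA addNr addr0 mulrDl
    -splitr.
have ndU : {homo U : i j / (i <= j)%N >-> i `<=` j}.
  move=> i j ij x [xi [e ie xe]]; split.
    by rewrite (lt_le_trans xi)// ler_nat.
  exists e => //; apply: le_lt_trans ie.
  by rewrite lef_pV2 ?posrE// ler_nat.
have DU x : D x -> exists m, U m x.
  move: oD; rewrite openE => /[apply] /nbhs_ballP[e /= e0 xe].
  have [k] := ltr_add_invr e0; rewrite add0r => ke.
  pose j := Num.trunc `|x|.
  exists (maxn k j); split.
    have := truncnS_gt `|x|; rewrite -/j => /lt_le_trans; apply.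
    by rewrite ler_nat ltnS leq_maxr.
  exists e => //; apply: le_lt_trans ke.
  by rewrite lef_pV2 ?posrE// ler_nat ltnS leq_maxl.
have clU m : compact (closure (U m)) /\ closure (U m) `<=` D.
  have H : closure (U m) `<=` [set x | `|x| <= m.+1%:R /\
    ball x m.+1%:R^-1 `<=` D].
    move=> x clx; split.
      apply/ler_addgt0Pl => e e0.
      have [y [[ym _]]] := clx _ (nbhsx_ballx x _ e0).
      rewrite rV_ballE /= => xy.
      rewrite -(subrK y x) (le_trans (ler_normD _ _))// lerD ?ltW//.
    move=> z; rewrite rV_ballE /= => xz.
    have d0 : 0 < m.+1%:R^-1 - `|x - z| by rewrite subr_gt0.
    have [y [[_ [e me yeD]]]] := clx _ (nbhsx_ballx x _ d0).
    rewrite rV_ballE /= => xy; apply: yeD; rewrite rV_ballE /=.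
    rewrite (le_lt_trans (ler_distD x _ _))// (lt_trans _ me)//.
    by rewrite -ltrBrDr distrC.
  split; last by move=> x /H[_]; apply; apply: ballxx; rewrite invr_gt0.
  apply: bounded_closed_compact; last exact: closed_closure.
  exists m.+1%:R; split; first exact: num_real.
  by move=> M mM x /H[xm _]; rewrite /= (le_trans xm)// ltW.
have [m0 Um0] := DU _ Dx0.
exists (fun j => connected_component (U (m0 + j)%N) x0).
have Uj j : U (m0 + j)%N x0 by apply: ndU Um0; exact: leq_addr.
have ndC i j : (i <= j)%N -> connected_component (U (m0 + i)%N) x0 `<=`
    connected_component (U (m0 + j)%N) x0.
  move=> ij; apply: connected_component_max.
  - exact: connected_component_refl.
  - apply: subset_trans; first exact: connected_component_sub.
    by apply: ndU; rewrite leq_add2l.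
  - exact: component_connected.
split.
- move=> j; split; first split.
  + by exists x0; exact: connected_component_refl.
  + exact: component_open.
  + exact: component_connected.
  have [cU cUD] := clU (m0 + j)%N.
  have sub : closure (connected_component (U (m0 + j)%N) x0) `<=` closure (U
    (m0 + j)%N).
    by apply: closureS; exact: connected_component_sub.
  split; last exact: subset_trans cUD.
  by apply: subclosed_compact sub => //; exact: closed_closure.
- by move=> j; exact: ndC.
set E := \bigcup_j _.
have ED : E `<=` D by move=> x [j _ /connected_component_sub /UD].
apply: cD.
- by exists x0; exists 0%N => //; exact: connected_component_refl.
- exists E; last by rewrite setIidr.
  by apply: bigcup_open => j _; exact: component_open.
(* If [x] in [D] is a limit point of [E], a small ball around it lies in some [U m] and meets one of
   the components. For a large index this connected ball lies in the same [U] as the component,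
   hence in the component. *)
- exists (closure E); first exact: closed_closure.
  apply/seteqP; split => [x Ex|x [Dx clx]].
    by split; [exact: ED|exact: subset_closure].
  have [m Um] := DU _ Dx.
  have : nbhs x (U m) by apply: open_nbhs_nbhs; split.
  move=> /nbhs_ballP[e /= e0 xU].
  have [y [[k _ Cy] xy]] := clx _ (nbhsx_ballx x _ e0).
  exists (maxn k m) => //.
  have Cy' : connected_component (U (m0 + maxn k m)%N) x0 y.
    by apply: ndC Cy; exact: leq_maxl.
  rewrite (same_connected_component Cy').
  apply: (@connected_component_max _ _ (ball x e)) => //.
  + apply: subset_trans xU _; apply: ndU.
    by rewrite (leq_trans (leq_maxr k m))// leq_addl.
  + exact: rV_ball_connected.
  + exact: ballxx.
Qed.

End exhaustion.

(** * Completeness of L^1 *)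

Section ae_fatou.
Context d (T : measurableType d) (R : realType).
Variables (mu : {measure set T -> \bar R}) (D : set T).
Local Open Scope ereal_scope.

(** The bound [c k] may vary with [k], as in the mean inequality, both sides of which depend on the
    function. *)
Lemma ae_fatou (h : nat -> T -> R) (g : T -> R) (c : nat ->
  \bar R) (l : \bar R) :
  measurable D -> (forall k, measurable_fun D (h k)) -> measurable_fun D g ->
  (forall k x, (0 <= h k x)%R) -> (forall x, (0 <= g x)%R) ->
  {ae mu, forall x, D x -> h k x @[k --> \oo] --> g x} ->
  (forall k, \int[mu]_(x in D) (h k x)%:E <= c k) -> c @ \oo --> l ->
  \int[mu]_(x in D) (g x)%:E <= l.
Proof.
move=> mD mh mg h0 g0 hg hc cl.
have mhE k : measurable_fun D (EFin \o h k) by exact/measurable_EFinP.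
apply: (@le_trans _ _ (\int[mu]_(x in D) limn_einf (fun k => (h k x)%:E))).
  apply: ae_ge0_le_integral => //.
  - by move=> x _; rewrite lee_fin.
  - exact/measurable_EFinP.
  - move=> x _; rewrite limn_einf_lim; apply: lime_ge;
      first exact: is_cvg_einfs.
    apply: nearW => m; apply: le_ereal_inf_tmp => _ [j _ <-].
    by rewrite lee_fin.
  - apply: (@measurableT_comp _ _ _ _ _ _ (fun x => - x)).
      exact: oppe_measurable.
    apply: measurable_fun_limn_esup => j.
    by apply: (@measurableT_comp _ _ _ _ _ _ (fun x => - x));
      [exact: oppe_measurable|exact: mhE].
  apply: filterS hg => x hgx /hgx {}hgx.
  have : (h k x)%:E @[k --> \oo] --> (g x)%:E by apply: cvg_EFin => //;
    exact: nearW.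
  by move=> /cvg_limn_einf_sup[-> _].
apply: le_trans (fatou _ _ _ _) _ => //; first by move=> k x _; rewrite lee_fin.
have [<- _] := cvg_limn_einf_sup cl.
rewrite !limn_einf_lim; apply: lee_lim; [exact: is_cvg_einfs..|].
apply: nearW => m; apply: le_ereal_inf_tmp => _ [j /= mj <-].
by apply: le_trans (hc j); apply: ereal_inf_lbound; exists j.
Qed.

End ae_fatou.

Section L1_fast_cauchy.
Context d (T : measurableType d) (R : realType).
Variable mu : {measure set T -> \bar R}.
Variable f : nat -> T -> R.
Local Open Scope ereal_scope.
Hypothesis mf : forall k, measurable_fun setT (f k).
Hypothesis fC : forall k j, (k <= j)%N ->
  \int[mu]_x `|f k x - f j x|%:E <= ((2^-1) ^+ k.+1)%:E.

Let sum_half n : (\sum_(0 <= i < n) (2^-1) ^+ i.+1 <= 1 :> R)%R.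
Proof.
suff -> : (\sum_(0 <= i < n) (2^-1) ^+ i.+1 = 1 - (2^-1) ^+ n :> R)%R.
  by rewrite gerBl exprn_ge0// invr_ge0.
elim: n => [|n IHn]; first by rewrite big_geq// expr0 subrr.
by rewrite big_nat_recr//= IHn exprS; lra.
Qed.

Let mfB k j : measurable_fun setT (fun x => `|f k x - f j x|%:E).
Proof.
by apply/measurable_EFinP; apply: measurableT_comp => //;
  exact: measurable_funB.
Qed.

Let ae_cvg : {ae mu, forall x, cvgn (f ^~ x)}.
Proof.
(* The increments have summable L^1 norms, so [h] is integrable and hence finite a.e.; there the
   telescoping series converges absolutely. *)
pose h x := \sum_(0 <= k <oo) `|f k x - f k.+1 x|%:E.
have mh : measurable_fun setT h.
  apply: ge0_emeasurable_sum => [k x _ _|k _]; first by rewrite lee_fin.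
  exact: mfB.
have h0 x : 0 <= h x by apply: nneseries_ge0 => k _ _; rewrite lee_fin.
have ih : mu.-integrable setT h.
  apply/integrableP; split => //.
  under eq_integral do rewrite gee0_abs//.
  rewrite integral_nneseries//.
  apply: (@le_lt_trans _ _ 1); last exact: ltry.
  apply: lime_le.
    by apply: is_cvg_nneseries => k _ _; apply: integral_ge0 => x _;
      rewrite lee_fin.
  apply: nearW => m; apply: (@le_trans _ _ (\sum_(0 <= i < m) ((2^-1) ^+
    i.+1)%:E)).
    by apply: lee_sum => i _; exact: fC.
  by rewrite sumEFin lee_fin.
have := integrable_ae measurableT ih.
apply: filterS => x /(_ I) hfin.
pose u k : R := (f k.+1 x - f k x)%R.
have cu : cvgn (series u).
  apply: normed_cvg; apply: nondecreasing_is_cvgn.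
    by apply: nondecreasing_series => k _ _; exact: normr_ge0.
  exists (fine (h x)) => _ [m _ <-].
  rewrite -lee_fin fineK// /normed_series_of seriesEnat /= -sumEFin.
  rewrite [X in X <= _](_ : _ = \sum_(0 <= i < m) `|f i x - f i.+1 x|%:E).
    by apply: nneseries_lim_ge => k _ _; rewrite lee_fin.
  by apply: eq_bigr => i _; rewrite distrC.
rewrite (_ : f ^~ x = (fun k => series u k + f 0%N x)%R).
  by apply: is_cvgD => //; exact: is_cvg_cst.
apply/funext => k; rewrite seriesEnat /= /u.
by rewrite (@telescope_sumr _ 0 k (f ^~ x))// subrK.
Qed.

Lemma L1_fast_cauchy : exists g : T -> R,
  [/\ measurable_fun setT g, {ae mu, forall x, f k x @[k --> \oo] --> g x} &
      forall k, \int[mu]_x `|f k x - g x|%:E <= ((2^-1) ^+ k.+1)%:E].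
Proof.
(* The upper limit is measurable without discarding a null set, and [fine] sends infinite values to
   0. *)
pose g x := fine (limn_esup (fun k => (f k x)%:E)).
have mg : measurable_fun setT g.
  apply: measurableT_comp => //; apply: measurable_fun_limn_esup => k.
  exact/measurable_EFinP.
have cg : {ae mu, forall x, f k x @[k --> \oo] --> g x}.
  apply: filterS ae_cvg => x /cvg_ex[l fl].
  have : (f k x)%:E @[k --> \oo] --> l%:E by apply: cvg_EFin => //;
    exact: nearW.
  by move=> /cvg_limn_einf_sup[_]; rewrite /g => ->.
exists g; split => // k.
apply: (@ae_fatou _ _ _ mu _ (fun j x => `|f k x - f (k + j)%N x|%R) _
  (fun=> ((2^-1) ^+ k.+1)%:E)) => //.
- move=> j; apply: measurableT_comp => //; exact: measurable_funB.
- by apply: measurableT_comp => //; exact: measurable_funB.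
- apply: filterS cg => x fg _; apply: cvg_norm; apply: cvgB;
    first exact: cvg_cst.
  by move: fg; rewrite -(cvg_shiftn k) /=; under eq_fun do rewrite addnC.
- by move=> j; apply: fC; exact: leq_addr.
- exact: cvg_cst.
Qed.

End L1_fast_cauchy.

Section L1_of_function.
Context d (T : measurableType d) (R : realType).
Variable mu : {measure set T -> \bar R}.
Local Open Scope ereal_scope.
Local Open Scope quotient_scope.

(** Equality holds only a.e. because [L1fun] reads the representative chosen by the quotient. *)
Lemma L1_of_function (f : T -> R) : measurable_fun setT f ->
  \int[mu]_x `|f x|%:E < +oo ->
  exists F : LspaceType1 mu, {ae mu, forall x, L1fun F x = f x}.
Proof.
move=> mf ffin.
pose mixin := isMeasurableFun.Build _ _ T (measurableTypeR R) f mf.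
pose pf : {mfun T >-> measurableTypeR R} := HB.pack f mixin.
pose q : {mfun_ mu, T >-> measurableTypeR R} := \pi pf.
have qf : {ae mu, forall x, (repr q : T -> R) x = f x}.
  have : repr q = pf %[mod {mfun_ mu, T >-> measurableTypeR R}] by rewrite
    reprK.
  move=> /eqquotP /asboolP.
  by apply: filterS => x /(_ I).
have mq : measurable_fun setT (repr q : T -> R) by exact: (@measurable_funPT _
  _ _ _ (repr q)).
have fq : finite_norm mu 1 (q : T -> R).
  rewrite /finite_norm Lnorm1.
  rewrite (ae_eq_integral (fun x => `|f x|%:E))//.
  - by apply/measurable_EFinP; apply: measurableT_comp.
  - by apply/measurable_EFinP; apply: measurableT_comp.
  - by apply: filterS qf => x /= + _; rewrite /aqEqMfun_to_fun => ->.
pose m := isFinLebesgue.Build d T R mu 1 (lexx 1) q fq.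
by exists (LebesgueSpace.Pack (LebesgueSpace.Class m)).
Qed.

End L1_of_function.

(** * Subharmonic representatives *)

Section superharmonic.
Context {R : realType}.
Local Open Scope ereal_scope.

(** Serves lower semicontinuity: [d] does not depend on the centres, and the gap [r^2 - q^2] absorbs
    the bound of [sqd_perturb]. *)
Lemma euclidean_ball_perturb n (q r : R) : (0 <= q)%R -> (q < r)%R ->
  exists2 d : R, (0 < d)%R & forall x y : 'rV[R]_n, (`|x - y| <= d)%R ->
    euclidean_ball x q `<=` euclidean_ball y r.
Proof.
move=> q0 qr; have r0 : (0 < r)%R by exact: le_lt_trans qr.
have q2r2 : (0 < r ^+ 2 - q ^+ 2)%R by rewrite subr_gt0 ltr_pXn2r ?nnegrE// ltW.
have q21 : (0 < 2 * q + 1)%R by lra.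
pose d := Num.min 1%R ((r ^+ 2 - q ^+ 2) / (n.+1%:R * (2 * q + 1)))%R.
exists d; first by rewrite lt_min ltr01/= divr_gt0// mulr_gt0.
move=> x y xy z zx.
have := sqd_perturb (norm_le_sqd q0 zx) xy.
have d0 : (0 <= d)%R by exact: le_trans xy.
have dle : (n%:R * (2 * q * d + d ^+ 2) <= r ^+ 2 - q ^+ 2)%R.
  have : (d <= (r ^+ 2 - q ^+ 2) / (n.+1%:R * (2 * q + 1)))%R.
    by rewrite ge_min lexx orbT.
  rewrite ler_pdivlMr ?mulr_gt0//; apply: le_trans.
  rewrite expr2 -mulrDl [leRHS](_ : _ = n.+1%:R * ((2 * q + 1) * d))%R;
    last by ring.
  rewrite ler_pM ?mulr_ge0 ?addr_ge0 ?mulr_ge0// ?ler_nat//.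
  by rewrite ler_wpM2r// lerD2l ge_min lexx.
move=> /le_trans/(_ dle); rewrite distrC ler_distl => /andP[_].
by move: zx; rewrite /euclidean_ball /= -!/(sqd _ _); lra.
Qed.

Lemma ae_rat (d : measure_display) (T : measurableType d)
    (mu : {measure set T -> \bar R}) (P : rat -> T -> Prop) :
  (forall q, {ae mu, forall x, P q x}) -> {ae mu, forall x q, P q x}.
Proof.
move=> H; have : {ae mu, forall x k, if @choice.unpickle rat k is Some q then P
  q x else True}.
  by apply/ae_foralln => k; case: (@choice.unpickle rat k) => [q|];
    [exact: H|exact: aeW].
by apply: filterS => x Hx q; have := Hx (choice.pickle q);
  rewrite choice.pickleK.
Qed.

(** The closures in the exhaustion are compact, so countably many of the given balls cover [D] and
    only countably many null sets are joined. *)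
Lemma ae_local n (D : set 'rV[R]_n) (P : 'rV[R]_n -> Prop) : domain D ->
  (forall x, D x -> exists2 e : R, (0 < e)%R &
    {ae lebesgue_rV n, forall y, ball x e y -> P y}) ->
  {ae lebesgue_rV n, forall y, D y -> P y}.
Proof.
move=> hD loc; have [Dj [Dj1 Dj2 DjE]] := domain_exhaustion hD.
have /choice[e he] : forall x, exists e : R, D x -> (0 < e)%R /\
    {ae lebesgue_rV n, forall y, ball x e y -> P y}.
  move=> x; have [/loc[e e0 h]|nDx] := pselect (D x); first by exists e.
  by exists 1%R.
have H j : {ae lebesgue_rV n, forall y, Dj j y -> P y}.
  have [_ [cK KD]] := Dj1 j.
  have [|s [sK Ks]] := finite_ball_cover (e := e) cK.
    by move=> x /KD /he[].
  have {sK} : {ae lebesgue_rV n, forall y p, p \in s -> ball p (e p) y -> P y}.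
    elim: s sK {Ks} => [|p s IHs] sK; first exact: aeW.
    have [h1 h2] : {ae lebesgue_rV n, forall y, ball p (e p) y -> P y} /\
      {ae lebesgue_rV n, forall y q, q \in s -> ball q (e q) y -> P y}.
    + split; first by apply: (he p _).2; apply: KD; apply: sK; rewrite mem_head.
      by apply: IHs => q qs; apply: sK; rewrite inE qs orbT.
    + apply: filterS2 h1 h2 => y h1 h2 q; rewrite inE => /orP[/eqP ->//|].
      exact: h2.
  apply: filterS => y Hy yj; have [p /= ps yp] := Ks y (subset_closure yj).
  exact: Hy yp.
have := ae_foralln H; apply: filterS => y Hy; rewrite -DjE => -[j _ yj].
exact: Hy yj.
Qed.

Lemma usc_measurable n (D : set 'rV[R]_n) (u : 'rV[R]_n -> \bar R) : open D ->
  (forall x, D x -> u x < +oo) ->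
  (forall x (a : R), D x -> u x < a%:E ->
    \forall y \near x, D y -> u y < a%:E) ->
  measurable_fun D u.
Proof.
move=> oD ufin usc mD;
  apply: (measurability _ (ErealGenCInfty.measurableE R)) => //.
move=> _ [_ [a ->] <-].
rewrite (_ : D `&` _ = D `\` (D `&` [set x | u x < a%:E])); last first.
  apply/seteqP; split => x /= [Dx].
    by rewrite in_itv/= andbT leNgt => /negP h; split => // -[].
  move=> h; split => //; rewrite in_itv/= andbT leNgt; apply/negP => h'.
  exact: h.
apply: measurableD => //; apply: open_measurable_rV.
rewrite openE => x [Dx ua].
have hD : \forall y \near x, D y by exact: open_nbhs_nbhs.
by apply: filterS2 hD (usc _ _ Dx ua) => y Dy h; split => //; exact: h.
Qed.

(* Mean inequality for [g = - u], [u] subharmonic; the exceptional null set may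
   depend on the radius. *)
Definition supermean n (D : set 'rV[R]_n) (g : 'rV[R]_n -> R) :=
  forall r : R, (0 < r)%R ->
  {ae lebesgue_rV n, forall x, euclidean_ball x r `<=` D ->
    \int[lebesgue_rV n]_(z in euclidean_ball x r) (g z)%:E <=
    (euclidean_ball_volume n r)%:E * (g x)%:E}.

Section representative.
Variables (n : nat) (D : set 'rV[R]_n.+1) (g : 'rV[R]_n.+1 -> R).
Hypotheses (hD : domain D) (mg : measurable_fun setT g).
Hypotheses (g0 : forall x, (0 <= g x)%R) (gD : supermean D g).
Hypothesis gloc : forall x, D x -> exists2 e : R, (0 < e)%R &
  \int[lebesgue_rV n.+1]_(z in ball x e) (g z)%:E < +oo.
Notation mu := (lebesgue_rV n.+1).
Notation V := (euclidean_ball_volume n.+1).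

Let I r x := \int[mu]_(z in euclidean_ball x r) (g z)%:E.

Let I0 r x : 0 <= I r x.
Proof. by apply: integral_ge0 => z _; rewrite lee_fin. Qed.

Let mgE : measurable_fun setT (EFin \o g). Proof. exact/measurable_EFinP. Qed.

Let I_sub x y q r : euclidean_ball x q `<=` euclidean_ball y r -> I q x <=
  I r y.
Proof.
move=> h; apply: ge0_subset_integral => //.
- exact: measurable_euclidean_ball.
- exact: measurable_euclidean_ball.
- exact: measurable_funTS.
- by move=> z _; rewrite lee_fin.
Qed.

Let I_mono x q r : (0 <= q)%R -> (q <= r)%R -> I q x <= I r x.
Proof.
move=> q0 qr; apply: I_sub => z zx; apply: le_trans zx _.
by rewrite ler_pXn2r ?nnegrE// (le_trans q0).
Qed.

(** Spheres being null, the smaller concentric balls exhaust the closed ball up to a null set. The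
    gap between [q] and [r] leaves room to move the centre or to pick a rational radius. *)
Let I_left x r c : (0 < r)%R -> c < I r x ->
  exists2 q : R, (0 < q < r)%R & c < I q x.
Proof.
move=> r0 cI.
(* With [k.+2] the radius is positive already at [k = 0]. *)
pose qk k := (r - r / k.+2%:R)%R.
have qk0 k : (0 < qk k)%R.
  by rewrite subr_gt0 ltr_pdivrMr// ltr_pMr// ltr1n.
have qkr k : (qk k < r)%R by rewrite gtrBl divr_gt0.
pose F k := euclidean_ball x (qk k).
have mF k : measurable (F k) by exact: measurable_euclidean_ball.
have ndF : nondecreasing_seq F.
  move=> i j ij; apply/subsetPset => z zx; apply: le_trans zx _.
  rewrite ler_pXn2r ?nnegrE ?(ltW (qk0 _))// lerD2l lerN2.
  by rewrite ler_pM2l// lef_pV2 ?posrE// ler_nat !ltnS.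
have bF : \bigcup_k F k = euclidean_ball x r `\` (sqd x @^-1` [set (r ^+ 2)%R]).
  apply/seteqP; split => [z [k _ zx]|z [zx /eqP zr]].
    have : (sqd x z < r ^+ 2)%R.
      apply: le_lt_trans zx _; rewrite ltr_pXn2r ?nnegrE ?(ltW (qk0 _))//.
      exact: ltW.
    by move=> h; split; [exact: ltW|move=> /= h'; move: h; rewrite h' ltxx].
  have {}zr : (sqd x z < r ^+ 2)%R by rewrite lt_neqAle zr.
  have s0 : (0 <= sqd x z)%R by apply: sumr_ge0 => i _; exact: sqr_ge0.
  pose t := Num.sqrt (sqd x z).
  have t0 : (0 <= t)%R by exact: sqrtr_ge0.
  have tr : (t < r)%R by rewrite -(@ltr_pXn2r _ 2)// ?nnegrE ?sqr_sqrtr// ltW.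
  have rt0 : (0 < (r - t) / r)%R by rewrite divr_gt0// subr_gt0.
  have [k] := ltr_add_invr rt0.
  rewrite add0r => hk; exists k => //.
  rewrite /F /euclidean_ball /= -/(sqd x z) -(sqr_sqrtr s0) -/t.
  rewrite ler_pXn2r ?nnegrE ?(ltW (qk0 _))// lerBrDr -lerBrDl.
  apply: (@le_trans _ _ (r * k.+1%:R^-1)%R).
    by rewrite ler_pM2l// lef_pV2 ?posrE// ler_nat.
  by rewrite mulrC -ler_pdivlMr// ltW.
have : \int[mu]_(z in F i) (g z)%:E @[i --> \oo] --> I r x.
  rewrite /I (ge0_negligible_integral _ _ _ _ (lebesgue_rV_sphere x (r ^+
    2)%R)).
  - rewrite -bF; apply: ge0_nondecreasing_set_cvg_integral => //.
    + by move=> i; exact: measurable_funTS.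
    + by move=> i z _; rewrite lee_fin.
  - exact: measurable_sqd_set.
  - exact: measurable_euclidean_ball.
  - exact: measurable_funTS.
  - by move=> z _; rewrite lee_fin.
move=> cvI; have [k _ hk] : \forall k \near \oo, c < \int[mu]_(z in F k) (g
  z)%:E.
  by apply: (cvI [set y | c < y]); exact: open_ereal_gt'.
by exists (qk k); [rewrite qk0 qkr|exact: (hk k (leqnn k))].
Qed.

(** The room beyond [r] makes admissibility of a radius an open condition on the centre; [s_mean]
    recovers the radii without room. *)
Let adm x r := (0 < r)%R /\ exists2 r' : R, (r < r')%R &
  euclidean_ball x r' `<=` D.

(** The element 0 makes the supremum nonnegative even where no radius is admissible. *)
Let means x := [set t : \bar R | t = 0 \/ exists2 r, adm x r & t =
  (V r)^-1%:E * I r x].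

Let s x := ereal_sup (means x).

Let s_ge0 x : 0 <= s x.
Proof. by apply: ereal_sup_ubound; left. Qed.

Let le_s x r : adm x r -> I r x <= (V r)%:E * s x.
Proof.
move=> a; have V0 := euclidean_ball_volume_gt0 n.+1 a.1.
rewrite -lee_pdivrMl//; apply: ereal_sup_ubound; right; exists r => //.
Qed.

(** If the mean at [x] with radius [r] exceeds [b], the integral over some smaller ball of radius
    [q] still exceeds [V r * b]. For [y] near [x] that ball lies in the one of radius [r] around
    [y], which is admissible. *)
Let s_lsc x (b : R) : b%:E < s x -> \forall y \near x, b%:E < s y.
Proof.
have [b0 _|b0] := ltP b 0%R.
  by apply/nbhs_ballP; exists 1%R => //= y _; apply: lt_le_trans (s_ge0 y);
    rewrite lte_fin.
move=> /ereal_sup_gt[_ [->|[r [r0 [r' rr' xr']] ->]]].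
  by rewrite lte_fin ltNge b0.
have V0 := euclidean_ball_volume_gt0 n.+1 r0.
rewrite lte_pdivlMl// => /(I_left r0)[q /andP[q0 qr] hq].
have [d1 d10 hd1] := @euclidean_ball_perturb n.+1 q r (ltW q0) qr.
pose r'' := ((r + r') / 2)%R.
have rr'' : (r < r'')%R by rewrite /r''; lra.
have r''r' : (r'' < r')%R by rewrite /r''; lra.
have r''0 : (0 <= r'')%R by rewrite (le_trans (ltW r0))// ltW.
have [d2 d20 hd2] := @euclidean_ball_perturb n.+1 r'' r' r''0 r''r'.
apply/nbhs_ballP; exists (Num.min d1 d2) => /=; first by rewrite lt_min d10 d20.
move=> y; rewrite rV_ballE /= lt_min => /andP[/ltW xy1 /ltW xy2].
have ay : adm y r.
  split => //; exists r'' => //; apply: subset_trans xr'; apply: hd2.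
  by rewrite distrC.
rewrite -(@lte_pmul2l _ (V r)%:E)//.
by apply: lt_le_trans hq _; apply: le_trans (le_s ay); apply: I_sub; exact: hd1.
Qed.

Let s_mean x r : (0 < r)%R -> euclidean_ball x r `<=` D -> I r x <=
  (V r)%:E * s x.
Proof.
move=> r0 xr; rewrite leNgt; apply/negP => /(I_left r0)[q /andP[q0 qr] hq].
have aq : adm x q by split => //; exists r.
have := le_lt_trans _ hq; move=> /(_ (I q x)).
rewrite ltxx => /(_ _)/negP; apply => //.
apply: le_trans (le_s aq) _; rewrite lee_wpmul2r// lee_fin.
by apply: le_euclidean_ball_volume; exact: ltW.
Qed.

(** The null set of [gD] depends on the radius, so only rational radii can be treated together. A
    violation at [r] persists at a nearby smaller rational radius, by [I_left] and the monotonicity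
    of volumes. *)
Let s_le_ae : {ae mu, forall x, D x -> s x <= (g x)%:E}.
Proof.
have H (q : rat) : {ae mu, forall x, (0 < ratr q :> R)%R ->
    euclidean_ball x (ratr q) `<=` D -> I (ratr q) x <=
      (V (ratr q))%:E * (g x)%:E}.
  have [q0|q0] := pselect (0 < ratr q :> R)%R; last by apply: aeW.
  by have := gD q0; apply: filterS => x Hx _; exact: Hx.
have := ae_rat H; apply: filterS => x Hx Dx.
apply: ge_ereal_sup => _ [->|[r [r0 [r' rr' xr']] ->]];
  first by rewrite lee_fin.
have V0 := euclidean_ball_volume_gt0 n.+1 r0.
rewrite lee_pdivrMl// leNgt; apply/negP => /(I_left r0)[q /andP[q0 qr] hq].
have [p] := rat_in_itvoo qr; rewrite in_itv/= => /andP[qp pr].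
have p0 : (0 < ratr p :> R)%R by exact: lt_trans qp.
have /(Hx _ p0) : euclidean_ball x (ratr p) `<=` D.
  apply: subset_trans xr' => z zx; apply: le_trans zx _.
  by rewrite ler_pXn2r ?nnegrE ?(ltW p0)// ?(ltW (lt_trans pr rr'))//
    (le_trans (ltW r0))// ltW.
apply/negP; rewrite -ltNge.
apply: (@le_lt_trans _ _ ((V r)%:E * (g x)%:E)).
  rewrite lee_wpmul2r ?lee_fin//.
  by apply: le_euclidean_ball_volume; exact: ltW.
by apply: lt_le_trans hq _; apply: I_mono; exact: ltW.
Qed.

(** With radius [rho / k.+1%:R], [mean_deviation] bounds the L^1 norm of the normalised deviation by
    [C / k.+1%:R]. Where the infimum of the deviations over [k] is 0, some mean is within any given
    [e] of [g]. *)
Let ge_s_ae : {ae mu, forall x, D x -> (g x)%:E <= s x}.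
Proof.
apply: ae_local => // x0 Dx0.
have [e1 e10 ge1] := gloc Dx0.
have /nbhs_ballP[e2 /= e20 xD] : nbhs x0 D.
  by case: hD => _ oD _; exact: open_nbhs_nbhs.
pose rho := (Num.min e1 e2 / 3)%R.
have rho0 : (0 < rho)%R by rewrite divr_gt0// lt_min e10.
have rho3 : (3 * rho = Num.min e1 e2)%R by rewrite /rho mulrC divfK.
have SD : ball x0 (3 * rho)%R `<=` D.
  by apply: subset_trans xD; apply: rV_ball_sub; rewrite rho3 ge_min lexx orbT.
have Sfin : \int[mu]_(z in ball x0 (3 * rho)%R) (g z)%:E < +oo.
  apply: subset_integral_fin ge1 => //.
  - exact: measurable_rV_ball.
  - exact: measurable_rV_ball.
  - by apply: rV_ball_sub; rewrite rho3 ge_min lexx.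
exists rho => //.
pose C := fine (\int[mu]_(z in ball x0 (3 * rho)%R) (g z)%:E).
have CE : \int[mu]_(z in ball x0 (3 * rho)%R) (g z)%:E = C%:E.
  by rewrite fineK// ge0_fin_numE// integral_ge0// => z _; rewrite lee_fin.
have C0 : (0 <= C)%R by rewrite fine_ge0// integral_ge0// => z _;
  rewrite lee_fin.
pose r k := (rho / k.+1%:R)%R.
have r0 k : (0 < r k)%R by rewrite divr_gt0.
have rrho k : (r k <= rho)%R by rewrite ler_pdivrMr// ler_peMr ?(ltW rho0)
  ?ler1n//.
have V0 k := euclidean_ball_volume_gt0 n.+1 (r0 k).
have mB : measurable (ball x0 rho) by exact: measurable_rV_ball.
pose w k x := (V (r k))^-1%:E * `|(V (r k))%:E * (g x)%:E - I (r k) x|.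
have w0 k x : 0 <= w k x by rewrite mule_ge0// lee_fin invr_ge0 ltW.
have mw k : measurable_fun (ball x0 rho) (w k).
  apply: measurable_funTS; apply: measurable_funeM;
    apply: measurableT_comp => //.
  apply: emeasurable_funB; first exact: measurable_funeM.
  by apply: measurable_ball_integral => // x; rewrite lee_fin.
have Hw k : \int[mu]_(x in ball x0 rho) w k x <= (C / k.+1%:R)%:E.
  rewrite /w ge0_integralZl//; last 2 first.
  - apply: measurable_funTS; apply: measurableT_comp => //.
    apply: emeasurable_funB; first exact: measurable_funeM.
    by apply: measurable_ball_integral => // x; rewrite lee_fin.
  - by rewrite lee_fin invr_ge0 ltW.
  rewrite lee_pdivrMl//.
  apply: le_trans (mean_deviation (r0 k) (rrho k) mgE _ Sfin _) _.
  - by move=> x; rewrite lee_fin.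
  - have := gD (r0 k); apply: filterS => x Hx xb; apply: Hx.
    apply: subset_trans SD; apply: (subset_euclidean_ball _ (lexx _));
      first exact: ltW.
    by move: xb; rewrite rV_ballE /= => xb;
      apply: lt_le_trans (ler_ltD (rrho k) xb) _; lra.
  rewrite CE -!EFinM lee_fin -mulrA ler_pM2l//.
  by rewrite /r (mulrAC rho) divff ?gt_eqF// mul1r mulrC.
(* The infimum over all [k] replaces an a.e. convergent subsequence: its integral is below every
   [C / k.+1%:R]. *)
pose h x := einfs (w ^~ x) 0%N.
have mh : measurable_fun (ball x0 rho) h by exact: measurable_fun_einfs.
have h0 x : 0 <= h x by apply: le_ereal_inf_tmp => _ [k _ <-].
have ih : \int[mu]_(x in ball x0 rho) `|h x| = 0.
  under eq_integral do rewrite gee0_abs//.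
  apply/eqP; rewrite eq_le integral_ge0// andbT.
  apply/lee_addgt0Pr => e e0; rewrite add0e.
  have [k] := ltr_add_invr (divr_gt0 e0 (ltr_wpDl C0 ltr01)).
  rewrite add0r => hk; apply: (@le_trans _ _ (C / k.+1%:R)%:E).
    apply: le_trans (Hw k); apply: ge0_le_integral => //.
    by move=> x _; apply: ereal_inf_lbound; exists k.
  rewrite lee_fin; move/ltW: hk; rewrite ler_pdivlMr ?ltr_wpDl//.
  apply: le_trans; rewrite mulrC ler_pM2l ?invr_gt0// lerDl//.
have /ae_eq_integral_abs := ih; move=> /(_ mB mh).
apply: filterS => x + xb => /(_ xb) /= hx0.
apply/lee_addgt0Pr => e e0.
have /ereal_inf_lt[_ [k _ <-] wk] : h x < e%:E by rewrite hx0 lte_fin.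
have ax : adm x (r k).
  split; first exact: r0; exists (2 * rho)%R;
    first by rewrite (le_lt_trans (rrho k))// ltr_pMl// ltr1n.
  apply: subset_trans SD; apply: (subset_euclidean_ball _ (lexx _));
    first by rewrite mulr_ge0// ltW.
  by move: xb; rewrite rV_ballE /= => xb;
    apply: lt_le_trans (ler_ltD (lexx _) xb) _; lra.
have Ifin : I (r k) x \is a fin_num.
  rewrite ge0_fin_numE//; apply: subset_integral_fin Sfin => //.
  - exact: measurable_euclidean_ball.
  - exact: measurable_rV_ball.
  - apply: (subset_euclidean_ball _ (lexx _)); first exact: ltW.
    by move: xb; rewrite rV_ballE /= => xb;
      apply: lt_le_trans (ler_ltD (rrho k) xb) _; lra.
move: wk; rewrite /w lte_pdivrMl// => wk.
rewrite -(@lee_pmul2l _ (V (r k))%:E) ?lte_fin// ge0_muleDr ?lee_fin ?(ltW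
  e0)//.
have := le_s ax.
move: wk Ifin; case: (I (r k) x) => // a wk _ la.
apply: le_trans (leeD la (ltW wk)).
by rewrite -!EFinM -EFinB abse_EFin -EFinD lee_fin -lerBlDl ler_norm.
Qed.

Lemma superharmonic_representative : exists u : 'rV[R]_n.+1 -> \bar R,
  [/\ subharmonic D u, forall x, D x -> u x <= 0 &
      {ae mu, forall x, D x -> u x = (- g x)%:E}].
Proof.
have sg : {ae mu, forall x, D x -> s x = (g x)%:E}.
  by apply: filterS2 s_le_ae ge_s_ae => x h1 h2 Dx; apply/eqP;
    rewrite eq_le h1// h2.
have usc x (a : R) : - s x < a%:E -> \forall y \near x, - s y < a%:E.
  move=> h; have {}h : (- a)%:E < s x by rewrite EFinN lteNl.
  by apply: filterS (s_lsc h) => y hy; rewrite lteNl -EFinN.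
have [_ oD _] := hD.
exists (fun x => - s x); split.
- split.
  + by move=> x _; rewrite (@le_lt_trans _ _ 0)// oppe_le0.
  + by move=> x a _ /usc; apply: filterS.
  move=> x r r0 xr; rewrite /ball_mean.
  have mB : measurable (euclidean_ball x r) by exact: measurable_euclidean_ball.
  have mDs : measurable_fun D (fun x => - s x).
    apply: usc_measurable => //.
      by move=> y _; rewrite (@le_lt_trans _ _ 0)// oppe_le0.
    by move=> y a _ /usc; apply: filterS.
  (* Since [s = g] a.e. in [D], the inequality [s_mean], about means of [g], becomes one about means
     of [s]. *)
  have -> : \int[mu]_(y in euclidean_ball x r) - s y = - I r x.
    rewrite /I -integral_ge0N; last by move=> z _; rewrite lee_fin.
    apply: ae_eq_integral => //.
    - by apply: measurable_funS mDs => //; exact: open_measurable_rV.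
    - by apply: measurable_funTS;
        apply: (@measurableT_comp _ _ _ _ _ _ (fun x => - x));
        [exact: oppe_measurable|].
    - by apply: filterS sg => y hy yx; rewrite hy//; exact: xr.
  rewrite [X in fine X](lebesgue_euclidean_ball x (ltW r0)) /=.
  rewrite muleN leeN2 lee_pdivrMl ?euclidean_ball_volume_gt0//.
  exact: s_mean.
- by move=> x _; rewrite oppe_le0.
- by apply: filterS sg => x h Dx; rewrite h// EFinN.
Qed.

End representative.
End superharmonic.

(** * Compactness *)

Section ultrafilter_pairs.
Variables (T : Type) (F : set_system T).
Hypothesis FU : UltraFilter F.

(** The image filter clusters at some [p] of the compact segment. Of the preimage of a ball around
    [p] and its complement, the ultrafilter contains one, and it cannot be the complement. *)
Lemma ultra_bounded_small {R : realType} (B : set T) (v : T -> R) (M k : R) :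
  F B -> (forall f, B f -> `|v f| <= M) -> 0 < k ->
  exists2 A, F A & forall f f', A f -> A f' -> `|v f - v f'| <= k.
Proof.
move=> FB vM k0.
have cM : compact `[- M, M]%classic by exact: segment_compact.
have [|p [_ clp]] := cM (v @ F) _.
  have : F (v @^-1` `[- M, M]%classic) by apply: filterS FB => f /vM;
    rewrite /= in_itv/= ler_norml.
  by [].
pose A := v @^-1` ball p (k / 2).
have [FA|FA] := in_ultra_setVsetC A FU.
  exists A => // f f' Af Af'; apply/ltW.
  by have := ball_splitr Af Af'; rewrite /ball/= distrC.
have k20 : 0 < k / 2 by rewrite divr_gt0.
by have [y [hy]] := clp (~` ball p (k / 2)) _ FA (nbhsx_ballx p _ k20).
Qed.

Lemma filter_pair_seq (I : eqType) (s : seq I) (P : I -> T -> T -> Prop) :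
  (forall p, p \in s -> exists2 A, F A & forall f f', A f -> A f' ->
    P p f f') ->
  exists2 A, F A & forall f f', A f -> A f' -> forall p, p \in s -> P p f f'.
Proof.
elim: s => [|p s IHs] H; first by exists setT => //; exact: filterT.
have [q qs|A FA hA] := IHs; first by apply: H; rewrite inE qs orbT.
have [B FB hB] := H p (mem_head _ _).
exists (A `&` B); first exact: filterI.
move=> f f' [Af Bf] [Af' Bf'] q; rewrite inE => /orP[/eqP ->|]; first exact: hB.
exact: hA.
Qed.

End ultrafilter_pairs.

Lemma integral_seq_cover d (T : measurableType d) (R : realType)
    (mu : {measure set T -> \bar R}) (I : eqType) (s : seq I) (B : I -> set T)
    (h : T -> \bar R) (c : R) (A : set T) :
  (forall p, measurable (B p)) -> measurable_fun setT h ->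
  (forall x, 0 <= h x)%E -> measurable A ->
  A `<=` \bigcup_(p in [set` s]) B p ->
  (forall p, p \in s -> (\int[mu]_(x in B p) h x <= c%:E)%E) ->
  (\int[mu]_(x in A) h x <= ((size s)%:R * c)%:E)%E.
Proof.
move=> mB mh h0; elim: s A => [|p s IHs] A mA As hc.
  rewrite (_ : A = set0) ?integral_set0 ?mul0r//.
  by apply/seteqP; split => // x /As[].
rewrite -(setUIDK A (B p)) ge0_integral_setU//; last 4 first.
- exact: measurableI.
- exact: measurableD.
- exact: measurable_funTS.
- by apply/disj_setPRL => x [_ nBx] [_ Bx].
rewrite (_ : (size (p :: s))%:R * c = c + (size s)%:R * c); last first.
  by rewrite /= -natr1 mulrDl mul1r addrC.
rewrite EFinD leeD//.
  apply: le_trans (hc p (mem_head _ _)); apply: ge0_subset_integral => //.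
  - exact: measurableI.
  - exact: measurable_funTS.
apply: IHs => [|x [Ax nBx]|q qs]; first exact: measurableD.
  have [q /=] := As x Ax; rewrite inE => /orP[/eqP -> //|qs Bq]; by exists q.
by apply: hc; rewrite inE qs orbT.
Qed.

Section SH1_theory.
Context {R : realType} {n : nat} {D : set 'rV[R]_n.+1} {phi : 'rV[R]_n.+1 -> R}.
Variables (hD : domain D) (hphi : norming D phi).
Let pc := norming_positive_continuous hphi.
Notation mu := (lebesgue_rV n.+1).
Notation L1D := (L1_weighted hD pc).
Notation SH := (SH1 hD pc).
Local Open Scope ereal_scope.

Let mD : measurable D.
Proof. by case: hD => _ oD _; exact: open_measurable_rV. Qed.

Let mphi : measurable_fun D phi.
Proof. exact: measurable_fun_positive_continuous hD pc. Qed.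

Let phi_gt0 x : D x -> (0 < phi x)%R. Proof. exact: pc.2. Qed.

Lemma ae_weighted (P : 'rV[R]_n.+1 -> Prop) :
  {ae weighted_measure hD pc, forall x, P x} -> {ae mu, forall x, D x -> P x}.
Proof.
move=> [N [mN N0 PN]].
have mND : measurable (N `&` D) by exact: measurableI.
have mp : measurable_fun (N `&` D) (EFin \o phi).
  by apply/measurable_EFinP; exact: measurable_funS mphi.
have : \int[mu]_(x in N `&` D) `|(EFin \o phi) x| = 0.
  rewrite -[RHS]N0; apply: eq_integral => x /set_mem[_ Dx].
  by rewrite gee0_abs// lee_fin ltW// phi_gt0.
move=> /(ae_eq_integral_abs mu mND mp); apply: filterS => x Hx Dx.
apply: contrapT => nPx; have Nx : N x by exact: PN.
by have := Hx (conj Nx Dx) => -[] /eqP; rewrite gt_eqF// phi_gt0.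
Qed.

Lemma compact_phi_ge K : compact K -> K `<=` D ->
  exists2 c : R, (0 < c)%R & forall x, K x -> (c <= phi x)%R.
Proof.
move=> cK KD; have [->|/set0P K0] := eqVneq K set0; first by exists 1%R.
have [|x /set_mem Kx hx] := EVT_min_rV (f := phi) K0 cK.
  exact: continuous_subspaceW pc.1.
exists (phi x); first by apply: phi_gt0; exact: KD.
by move=> y Ky; apply: hx; exact/mem_set.
Qed.

Lemma compact_phi_le K : compact K -> K `<=` D ->
  exists2 c : R, (0 < c)%R & forall x, K x -> (phi x <= c)%R.
Proof.
move=> cK KD; have [->|/set0P K0] := eqVneq K set0; first by exists 1%R.
have [|x /set_mem Kx hx] := EVT_max_rV (f := phi) K0 cK.
  exact: continuous_subspaceW pc.1.
exists (phi x); first by apply: phi_gt0; exact: KD.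
by move=> y Ky; apply: hx; exact/mem_set.
Qed.

Let mL1 (f : L1D) : measurable_fun setT (L1fun f).
Proof. exact: measurable_L1fun. Qed.

Let mL1phi (f : L1D) E : measurable E -> E `<=` D ->
  measurable_fun E (fun x => (`|L1fun f x| * phi x)%:E).
Proof.
move=> mE ED; apply/measurable_EFinP; apply: measurable_funM.
  by apply: measurable_funTS; exact: measurableT_comp.
exact: measurable_funS mphi.
Qed.

(** Transfers to the real representative what is known of [u]. The function [u] itself is kept
    because the uniform bounds in [norming] are about functions. *)
Lemma SH1P (f : L1D) : SH f -> exists u : 'rV[R]_n.+1 -> \bar R,
  [/\ negative_subharmonic D u, weighted_norm phi D u <= 1,
      {ae mu, forall x, D x -> (L1fun f x <= 0)%R},
      supermean D (fun x => `|L1fun f x|%R) &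
      forall E, measurable E -> E `<=` D ->
        \int[mu]_(x in E) (`|L1fun f x| * phi x)%:E = weighted_norm phi E u].
Proof.
move=> [u [hu u1 fu]]; have [[u_fin u_usc u_mean] u0 _] := hu.
have mu_ : measurable_fun D u.
  by apply: usc_measurable => //; case: hD.
have f0 : {ae mu, forall x, D x -> (L1fun f x <= 0)%R}.
  by apply: filterS fu => x h Dx; rewrite -lee_fin h// u0.
exists u; split => //.
  move=> r r0; have V0 := euclidean_ball_volume_gt0 n.+1 r0.
  apply: filterS2 (fu) (f0) => x fux f0x xr.
  have Dx : D x.
    apply: xr; rewrite /euclidean_ball/= big1 ?sqr_ge0// => i _.
    by rewrite subrr expr0n.
  have mB : measurable (euclidean_ball x r) by exact: measurable_euclidean_ball.
  have := u_mean x r r0 xr; rewrite /ball_mean.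
  have -> : \int[mu]_(y in euclidean_ball x r) u y =
      - \int[mu]_(y in euclidean_ball x r) `|L1fun f y|%:E.
    rewrite -integral_ge0N; last by move=> z _; rewrite lee_fin.
    apply: ae_eq_integral => //.
    - exact: measurable_funS mu_.
    - apply: (@measurableT_comp _ _ _ _ _ _ (fun x => - x));
        first exact: oppe_measurable.
      apply/measurable_EFinP; apply: measurable_funTS; exact: measurableT_comp.
    - apply: filterS2 (fu) (f0) => y fuy f0y /xr Dy.
      by rewrite -fuy// ler0_norm ?f0y// EFinN oppeK.
  rewrite [X in fine X](lebesgue_euclidean_ball x (ltW r0)) /=.
  rewrite -fux// muleN leeNr lee_pdivrMl// -EFinN.
  by rewrite -ler0_norm ?f0x.
move=> E mE ED; apply: ae_eq_integral => //.
- exact: mL1phi.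
- apply: emeasurable_funM.
    by apply: measurableT_comp => //; exact: measurable_funS mu_.
  by apply/measurable_EFinP; exact: measurable_funS mphi.
- by apply: filterS fu => x fux /ED Dx; rewrite -fux.
Qed.

(** On a closed ball inside [D], [phi] is at least some [c > 0], so the weighted norm controls the
    unweighted one with [C = c^-1]. *)
Lemma SH1_ball_bound x : D x -> exists (rho C : R),
  [/\ (0 < rho)%R, (0 <= C)%R, ball x (3 * rho)%R `<=` D &
      forall f, SH f ->
        \int[mu]_(z in ball x (3 * rho)%R) `|L1fun f z|%:E <= C%:E].
Proof.
move=> Dx; have /nbhs_ballP[e /= e0 xD] : nbhs x D.
  by case: hD => _ oD _; exact: open_nbhs_nbhs.
pose rho := (e / 6)%R.
have rho0 : (0 < rho)%R by rewrite divr_gt0.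
have rho3 : (3 * rho < e)%R by rewrite /rho; lra.
have KD : [set y : 'rV[R]_n.+1 | `|y - x| <= 3 * rho]%R `<=` D.
  move=> y /= yx; apply: xD; rewrite rV_ballE /= distrC.
  exact: le_lt_trans rho3.
have [c c0 hc] := compact_phi_ge (@closed_norm_ball_compact _ _ x (3 * rho)%R)
  KD.
have bK : ball x (3 * rho)%R `<=` [set y : 'rV[R]_n.+1 | `|y - x| <= 3 * rho]%R.
  by move=> y; rewrite rV_ballE /= distrC => /ltW.
have bD := subset_trans bK KD.
have mb : measurable (ball x (3 * rho)%R) by exact: measurable_rV_ball.
exists rho, c^-1%R; split => //; first by rewrite invr_ge0 ltW.
move=> f /SH1P[u [_ u1 _ _ hE]].
rewrite -[leRHS]mule1 -lee_pdivrMl ?invr_gt0// invrK.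
apply: le_trans u1; rewrite -hE//.
apply: (@le_trans _ _ (\int[mu]_(z in ball x (3 * rho)%R) (`|L1fun f z| * phi
  z)%:E)).
  rewrite -ge0_integralZl//; last 2 first.
  - by apply/measurable_EFinP; apply: measurable_funTS; exact: measurableT_comp.
  - by rewrite lee_fin ltW.
  apply: ge0_le_integral => //.
  - by move=> z _; rewrite mule_ge0// lee_fin// ltW.
  - apply: measurable_funeM; apply/measurable_EFinP; apply: measurable_funTS.
    exact: measurableT_comp.
  - exact: mL1phi.
  move=> z /bK zb; rewrite -EFinM lee_fin mulrC ler_wpM2l//.
  exact: hc.
apply: ge0_subset_integral => //; first exact: mL1phi.
by move=> z Dz; rewrite lee_fin mulr_ge0// ltW// phi_gt0.
Qed.

Section ultrafilter_on_SH1.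
Variable F : set_system L1D.
Hypotheses (FU : UltraFilter F) (FSH : F SH).

(** [rho] is chosen before [e]: a finite cover by such balls can be fixed first, and the accuracy
    adapted to the number of balls afterwards. *)
Lemma SH1_local_cauchy x : D x -> exists2 rho : R, (0 < rho)%R &
  forall e : R, (0 < e)%R -> exists2 A, F A & forall f f', A f -> A f' ->
    \int[mu]_(z in ball x rho) `| `|L1fun f z| - `|L1fun f' z| |%:E <= e%:E.
Proof.
move=> Dx; have [rho [C [rho0 C0 bD hC]]] := SH1_ball_bound Dx.
exists rho => // e e0.
have [r [k [s [[r0 rrho] k0 hs H]]]] := local_precompactness x rho0 C0 e0.
have Sp p : p \in s -> euclidean_ball p r `<=` ball x (3 * rho)%R.
  move=> ps; apply: (subset_euclidean_ball _ (d := rho)); first exact: ltW.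
    by rewrite distrC; exact: hs.
  by move: rrho rho0; lra.
have IC f p : SH f -> p \in s ->
    \int[mu]_(z in euclidean_ball p r) `|L1fun f z|%:E <= C%:E.
  move=> hf ps; apply: le_trans (hC f hf); apply: ge0_subset_integral => //.
  - exact: measurable_euclidean_ball.
  - exact: measurable_rV_ball.
  - by apply/measurable_EFinP; apply: measurable_funTS; exact: measurableT_comp.
  - exact: Sp.
have I0 (f : L1D) p : 0 <= \int[mu]_(z in euclidean_ball p r) `|L1fun f z|%:E.
  by apply: integral_ge0 => z _; rewrite lee_fin.
have Ifin f p : SH f -> p \in s ->
    \int[mu]_(z in euclidean_ball p r) `|L1fun f z|%:E \is a fin_num.
  move=> hf ps; rewrite ge0_fin_numE//.
  exact: le_lt_trans (IC _ _ hf ps) (ltry _).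
pose v p (f : L1D) := fine (\int[mu]_(z in euclidean_ball p r) `|L1fun f z|%:E).
have [A FA hA] : exists2 A, F A & forall f f', A f -> A f' ->
    forall p, p \in s -> (`|v p f - v p f'| <= k)%R.
  apply: filter_pair_seq => p ps.
  apply: (ultra_bounded_small FU (v := v p) (M := C) FSH) => // f hf.
  by rewrite ger0_norm ?fine_ge0// -lee_fin fineK; [exact: IC|exact: Ifin].
exists (A `&` SH); first exact: filterI.
have prop f : SH f -> [/\ measurable_fun setT (fun x => `|L1fun f x|%R),
    forall x, (0 <= `|L1fun f x|)%R,
    \int[mu]_(z in ball x (3 * rho)%R) `|L1fun f z|%:E <= C%:E &
    {ae mu, forall y, ball x (2 * rho)%R y ->
       \int[mu]_(z in euclidean_ball y r) `|L1fun f z|%:E <=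
       (euclidean_ball_volume n.+1 r)%:E * `|L1fun f y|%:E}].
  move=> hf; split => //; [exact: measurableT_comp|exact: hC|].
  have [u [_ _ _ sm _]] := SH1P hf; have := sm r r0.
  apply: filterS => y Hy yb; apply: Hy; apply: subset_trans bD.
  apply: (subset_euclidean_ball _ (lexx _)); first exact: ltW.
  by move: yb; rewrite rV_ballE /= => yb;
    apply: lt_le_trans (ler_ltD rrho yb) _; lra.
move=> f f' [Af hf] [Af' hf']; apply: (H _ _ (prop f hf) (prop f' hf')).
move=> p ps; have := hA f f' Af Af' p ps.
by rewrite -lee_fin -abse_EFin EFinB !fineK//; [exact: Ifin|exact: Ifin].
Qed.

End ultrafilter_on_SH1.

Let mL1abs (f : L1D) : measurable_fun setT (fun x => `|L1fun f x|%R).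
Proof. by apply: measurableT_comp => //; exact: measurable_L1fun. Qed.

Let mphiM (h : 'rV[R]_n.+1 -> R) E : measurable_fun setT h -> measurable E ->
  E `<=` D -> measurable_fun E (fun x => (h x * phi x)%:E).
Proof.
move=> mh mE ED; apply/measurable_EFinP; apply: measurable_funM.
  exact: measurable_funTS.
exact: measurable_funS mphi.
Qed.

Lemma SH1_cauchy (F : set_system L1D) (e : R) :
  UltraFilter F -> F SH -> (0 < e)%R ->
  exists2 A, F A & forall f f', A f -> A f' -> (mdist f f' <= e)%R.
Proof.
move=> FU FSH e0.
have [Dj [Dj1 Dj2 DjE]] := domain_exhaustion hD.
have [_ _ _ /(_ Dj Dj1 Dj2 DjE)[eps [eps0 epscvg heps]]] := hphi.
(* Outside [Dj j], [f] and [f'] contribute at most [e / 4] each; the remaining [e / 2] is left for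
   [Dj j]. *)
have [j hj] : exists j, (eps j <= e / 4)%R.
  have e40 : (0 < e / 4)%R by rewrite divr_gt0.
  have [j _ h] := cvgr_lt _ epscvg _ e40.
  by exists j; apply/ltW; exact: (h j (leqnn j)).
have [[_ oDj _] [cK KD]] := Dj1 j.
have DjD : Dj j `<=` D by apply: subset_trans KD; exact: subset_closure.
have mDj : measurable (Dj j) by exact: open_measurable_rV.
have [Phi Phi0 hPhi] := compact_phi_le cK KD.
have /choice[rho hrho] : forall x, exists rho : R, D x -> (0 < rho)%R /\
    forall e : R, (0 < e)%R -> exists2 A, F A & forall f f', A f -> A f' ->
    \int[mu]_(z in ball x rho) `| `|L1fun f z| - `|L1fun f' z| |%:E <= e%:E.
  move=> x; have [/(SH1_local_cauchy FU FSH)[r r0 h]|nDx] := pselect (D x).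
    by exists r.
  by exists 1%R.
have [|s [sK Ks]] := finite_ball_cover (e := rho) cK.
  by move=> x /KD /hrho[].
pose N : R := (size s)%:R.
have N0 : (0 <= N)%R by [].
have N1 : (0 < N + 1)%R by rewrite ltr_wpDl.
(* Chosen so that [Phi * N * c <= e / 2], with [N + 1] in place of [N] for an empty cover. *)
pose c := (e / (2 * Phi * (N + 1)))%R.
have c0 : (0 < c)%R by rewrite divr_gt0 ?mulr_gt0.
have [A FA hA] : exists2 A, F A & forall f f', A f -> A f' -> forall p,
  p \in s ->
    \int[mu]_(z in ball p (rho p)) `| `|L1fun f z| - `|L1fun f' z| |%:E <= c%:E.
  apply: filter_pair_seq => p ps.
  by apply: (hrho p _).2 => //; apply: KD; exact: sK.
exists (A `&` SH); first exact: filterI.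
move=> f f' [Af hf] [Af' hf'].
have [u [hu u1 f0 _ uE]] := SH1P hf.
have [u' [hu' u1' f0' _ uE']] := SH1P hf'.
pose h (x : 'rV[R]_n.+1) : R := `| `|L1fun f x| - `|L1fun f' x| |%R.
have mh : measurable_fun setT h.
  by apply: measurableT_comp => //; exact: measurable_funB.
have hge0 x : (0 <= h x)%R by exact: normr_ge0.
have h0 E x : E `<=` D -> E x -> 0 <= (h x * phi x)%:E.
  by move=> ED Ex; rewrite lee_fin; apply: mulr_ge0;
    [exact: hge0|exact/ltW/phi_gt0/ED].
have mDD : measurable (D `\` Dj j) by exact: measurableD.
have DDD : D `\` Dj j `<=` D by move=> x [].
have tail (k : L1D) w : negative_subharmonic D w -> weighted_norm phi D w <=
  1 ->
    (forall E, measurable E -> E `<=` D ->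
      \int[mu]_(x in E) (`|L1fun k x| * phi x)%:E = weighted_norm phi E w) ->
    \int[mu]_(x in D `\` Dj j) (`|L1fun k x| * phi x)%:E <= (e / 4)%:E.
  move=> hw w1 wE; rewrite wE//; apply: le_trans (heps w hw j) _.
  apply: (@le_trans _ _ ((eps j)%:E * 1));
    first by rewrite lee_wpmul2l// lee_fin ltW.
  by rewrite mule1 lee_fin.
rewrite -lee_fin L1_weighted_distE.
(* Both functions are nonpositive a.e. on [D], so passing to absolute values does not change their
   distance. *)
have -> : \int[mu]_(x in D) (`|L1fun f x - L1fun f' x| * phi x)%:E =
    \int[mu]_(x in D) (h x * phi x)%:E.
  apply: ae_eq_integral => //.
  - apply: mphiM => //; apply: measurableT_comp => //.
    by apply: measurable_funB; exact: measurable_L1fun.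
  - exact: mphiM.
  - apply: filterS2 f0 f0' => x h1 h2 Dx; rewrite /h.
    rewrite (ler0_norm (h1 Dx)) (ler0_norm (h2 Dx)) opprK.
    by rewrite [in RHS]addrC [in RHS]distrC.
have DU : Dj j `|` D `\` Dj j = D.
  by rewrite -[RHS](setUIDK D (Dj j)) (setIidr DjD).
rewrite -[in leLHS]DU.
have dDj : [disjoint Dj j & D `\` Dj j] by apply/disj_setPRL => x [_ nDx].
rewrite ge0_integral_setU//; last 2 first.
- by rewrite DU; exact: mphiM.
- by move=> x; rewrite DU; exact: h0.
rewrite [e]splitr EFinD leeD//.
  apply: (@le_trans _ _ (Phi%:E * \int[mu]_(x in Dj j) (h x)%:E)).
    rewrite -ge0_integralZl//; last 3 first.
    - by apply/measurable_EFinP; exact: measurable_funTS.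
    - by move=> x _; rewrite lee_fin.
    - by rewrite lee_fin ltW.
    apply: ge0_le_integral => //.
    - by move=> x; exact: h0.
    - exact: mphiM.
    - by apply: measurable_funeM; apply/measurable_EFinP;
        exact: measurable_funTS.
    move=> x Dx; rewrite -EFinM lee_fin mulrC ler_wpM2r//.
    by apply: hPhi; exact: subset_closure.
  apply: (@le_trans _ _ (Phi%:E * (N * c)%:E)).
    rewrite lee_wpmul2l ?lee_fin ?(ltW Phi0)//.
    apply: (integral_seq_cover (B := fun p => ball p (rho p))) => //.
    - by move=> p; exact: measurable_rV_ball.
    - exact/measurable_EFinP.
    - by apply: subset_trans Ks; exact: subset_closure.
    - by move=> p ps; exact: hA.
  rewrite -EFinM lee_fin /c.
  rewrite (_ : Phi * _ = e / 2 * (N / (N + 1)))%R; last first.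
    by field; rewrite !gt_eqF.
  by rewrite ler_piMr ?divr_ge0 ?(ltW e0)// ler_pdivrMr// mul1r lerDl.
apply: (@le_trans _ _ (\int[mu]_(x in D `\` Dj j)
    ((`|L1fun f x| * phi x)%:E + (`|L1fun f' x| * phi x)%:E))).
  apply: ge0_le_integral => //.
  - by move=> x; exact: h0.
  - exact: mphiM.
  - by apply: emeasurable_funD; exact: mphiM.
  move=> x [Dx _]; rewrite -EFinD lee_fin -mulrDl ler_wpM2r ?(ltW (phi_gt0
    Dx))//.
  by rewrite (le_trans (ler_normB _ _))// !normr_id.
rewrite ge0_integralD//; last 4 first.
- by move=> x [Dx _]; rewrite lee_fin mulr_ge0// ltW// phi_gt0.
- exact: mphiM.
- by move=> x [Dx _]; rewrite lee_fin mulr_ge0// ltW// phi_gt0.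
- exact: mphiM.
rewrite (_ : e / 2 = e / 4 + e / 4)%R; last by lra.
by rewrite EFinD leeD//; [exact: tail uE|exact: tail uE'].
Qed.

Lemma SH1_ae_limit (f : nat -> L1D) (g : L1D) : (forall k, SH (f k)) ->
  {ae mu, forall x, D x -> L1fun (f k) x @[k --> \oo] --> L1fun g x} -> SH g.
Proof.
move=> hf fg.
have f0 : {ae mu, forall x k, D x -> (L1fun (f k) x <= 0)%R}.
  by apply/ae_foralln => k; have [u []] := SH1P (hf k).
have g0 : {ae mu, forall x, D x -> (L1fun g x <= 0)%R}.
  apply: filterS2 fg f0 => x fgx fx Dx.
  have cfg := fgx Dx; apply: (cvgr_to_le cfg); apply: nearW => k.
  exact: fx.
have fg_abs : {ae mu, forall x, D x -> `|L1fun (f k) x|%R @[k --> \oo] -->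
  `|L1fun g x|%R}.
  by apply: filterS fg => x fgx Dx; apply: cvg_norm; exact: fgx.
have g1 : \int[mu]_(x in D) (`|L1fun g x| * phi x)%:E <= 1.
  (* [ae_fatou] asks for nonnegativity everywhere, whereas the sign of [phi] is known only on
     [D]. *)
  have -> : \int[mu]_(x in D) (`|L1fun g x| * phi x)%:E =
      \int[mu]_(x in D) (`|L1fun g x| * `|phi x|)%:E.
    by apply: eq_integral => x /set_mem Dx; rewrite (gtr0_norm (phi_gt0 Dx)).
  apply: (@ae_fatou _ _ _ mu D (fun k x => `|L1fun (f k) x| * `|phi x|)%R _
    (cst 1)) => //.
  - move=> k; apply: measurable_funM; first exact: measurable_funTS.
    exact: measurableT_comp.
  - by apply: measurable_funM;
      [exact: measurable_funTS|exact: measurableT_comp].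
  - by apply: filterS fg_abs => x h Dx; apply: cvgM; [exact: h|exact: cvg_cst].
  - move=> k; have [u [_ u1 _ _ uE]] := SH1P (hf k); apply: le_trans u1.
    rewrite -uE// le_eqVlt; apply/orP; left; apply/eqP.
    by apply: eq_integral => x /set_mem Dx; rewrite (gtr0_norm (phi_gt0 Dx)).
  - exact: cvg_cst.
have gsm : supermean D (fun x => `|L1fun g x|%R).
  move=> r r0.
  have fsm : {ae mu, forall x k, euclidean_ball x r `<=` D ->
      \int[mu]_(z in euclidean_ball x r) `|L1fun (f k) z|%:E <=
      (euclidean_ball_volume n.+1 r)%:E * `|L1fun (f k) x|%:E}.
    by apply/ae_foralln => k; have [u [_ _ _ + _]] := SH1P (hf k); exact.
  apply: filterS2 fsm (fg_abs) => x fx fgx xr.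
  have Dx : D x.
    apply: xr; rewrite /euclidean_ball/= big1 ?sqr_ge0// => i _.
    by rewrite subrr expr0n.
  apply: (@ae_fatou _ _ _ mu _ (fun k x => `|L1fun (f k) x|)%R _
    (fun k => (euclidean_ball_volume n.+1 r)%:E * `|L1fun (f k) x|%:E)) => //.
  - exact: measurable_euclidean_ball.
  - by move=> k; exact: measurable_funTS.
  - exact: measurable_funTS.
  - by apply: filterS fg_abs => y h /xr; exact: h.
  - by move=> k; exact: fx.
  - under eq_fun do rewrite -EFinM; rewrite -EFinM.
    apply: cvg_EFin; first exact: nearW.
    by apply: cvgM; [exact: cvg_cst|exact: fgx].
have gloc x : D x -> exists2 e : R, (0 < e)%R &
    \int[mu]_(z in ball x e) `|L1fun g z|%:E < +oo.
  move=> Dx; have [rho [C [rho0 C0 bD hC]]] := SH1_ball_bound Dx.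
  exists (3 * rho)%R; first by rewrite mulr_gt0.
  apply: (@le_lt_trans _ _ C%:E); last exact: ltry.
  apply: (@ae_fatou _ _ _ mu _ (fun k x => `|L1fun (f k) x|)%R _ (cst C%:E)) =>
    //.
  - exact: measurable_rV_ball.
  - by move=> k; exact: measurable_funTS.
  - exact: measurable_funTS.
  - by apply: filterS fg_abs => y h /bD; exact: h.
  - by move=> k; exact: hC.
  - exact: cvg_cst.
have [u [ush u0 ug]] := superharmonic_representative hD (mL1abs g) (fun x =>
  normr_ge0 _) gsm gloc.
have gu : {ae mu, forall x, D x -> (L1fun g x)%:E = u x}.
  apply: filterS2 ug (g0) => x ux gx Dx.
  by rewrite ux// ler0_norm ?gx// opprK.
exists u; split => //.
  (* Were [u] equal to -oo throughout [D], the a.e. equality with a finite function would make the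
     nonempty open set [D] null. *)
  split => //; apply: contrapT => nu.
  have uNy x : D x -> u x = -oo.
    by move=> Dx; apply: contrapT => /eqP ux; apply: nu; exists x.
  have : mu.-negligible D.
    have [N [mN N0 gN]] := gu; exists N; split => // x Dx; apply: gN => /= h.
    by have := h Dx; rewrite uNy.
  have [[x0 Dx0] oD _] := hD.
  have /nbhs_ballP[e /= e0 xD] : nbhs x0 D by exact: open_nbhs_nbhs.
  move=> /(negligibleP _ mD) D0.
  have := lebesgue_rV_ball_gt0 x0 e0; rewrite ltNge => /negP; apply.
  apply: (@le_trans _ _ (mu D)); last by rewrite [leLHS]D0.
  by apply: le_measure xD; apply/mem_set; [exact: measurable_rV_ball|exact: mD].
apply: le_trans g1; rewrite le_eqVlt; apply/orP; left; apply/eqP.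
apply: ae_eq_integral => //.
- apply: emeasurable_funM.
    apply: measurableT_comp => //; apply: usc_measurable; last 2 first.
    + by case: ush.
    + by case: ush.
    by case: hD.
  exact/measurable_EFinP.
- exact: mphiM.
- by apply: filterS gu => x h Dx; rewrite -h.
Qed.

(** The ultrafilter need not come from a sequence. A sequence is drawn from its sets [A k] of small
    diameter, and its limit [G] attracts the whole ultrafilter, since each [A k] lies within
    [2^-(k+1)] of [f k]. *)
Lemma SH1_compact : compact SH.
Proof.
rewrite compact_ultra => F FU FSH.
have half0 k : (0 < (2^-1) ^+ k.+1 :> R)%R by rewrite exprn_gt0// invr_gt0.
have /choice[A /all_and2[FA hA]] : forall k, exists A : set L1D, F A /\
    forall f f', A f -> A f' -> (mdist f f' <= (2^-1) ^+ k.+1)%R.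
  by move=> k; have [A FA hA] := SH1_cauchy FU FSH (half0 k); exists A.
(* Intersecting the first sets puts [f j] in [A k] whenever [k <= j], which makes the sequence
   Cauchy at a geometric rate. *)
have FB k : F [set f | SH f /\ forall i, (i <= k)%N -> A i f].
  elim: k => [|k IHk].
    by apply: filterS2 FSH (FA 0%N) => f hf Af; split => // i;
      rewrite leqn0 => /eqP ->.
  apply: filterS2 IHk (FA k.+1) => f [hf h] Af; split => // i.
  by rewrite leq_eqVlt => /orP[/eqP ->//|]; exact: h.
have /choice[f /all_and2[hf Af]] : forall k, exists f, SH f /\ forall i, (i <=
  k)%N -> A i f.
  by move=> k; have [f] := filter_ex (FB k); exists f.
have mL (h : L1D) : measurable_fun setT (L1fun h) by exact: measurable_L1fun.
have distE (h h' : L1D) : (mdist h h')%:E =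
    \int[weighted_measure hD pc]_x `|L1fun h x - L1fun h' x|%:E by exact:
      L1distE.
have [|g [mg fg hg]] := L1_fast_cauchy (mu := weighted_measure hD pc) (fun k =>
  mL (f k)).
  by move=> k j kj; rewrite -distE lee_fin; apply: hA; exact: Af.
have gfin : \int[weighted_measure hD pc]_x `|g x|%:E < +oo.
  apply: (@le_lt_trans _ _ (\int[weighted_measure hD pc]_x
      (`|L1fun (f 0%N) x - g x|%:E + `|L1fun (f 0%N) x|%:E))).
    apply: ge0_le_integral => //.
    - by apply/measurable_EFinP; exact: measurableT_comp.
    - apply: emeasurable_funD; apply/measurable_EFinP;
        apply: measurableT_comp => //.
      exact: measurable_funB.
    move=> x _; rewrite -EFinD lee_fin -[in leLHS](subKr (L1fun (f 0%N) x) (g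
      x)).
    by rewrite [leRHS]addrC ler_normB.
  rewrite ge0_integralD//; last 2 first.
  - apply/measurable_EFinP; apply: measurableT_comp => //;
      exact: measurable_funB.
  - by apply/measurable_EFinP; exact: measurableT_comp.
  rewrite lte_add_pinfty//; first exact: le_lt_trans (hg 0%N) (ltry _).
  by have := L1fun_finite (f 0%N); rewrite Lnorm1.
have [G GE] := L1_of_function mg gfin.
have dfG k : (mdist (f k) G <= (2^-1) ^+ k.+1)%R.
  rewrite -lee_fin distE; apply: le_trans (hg k).
  rewrite le_eqVlt; apply/orP; left; apply/eqP; apply: ae_eq_integral => //.
  - apply/measurable_EFinP; apply: measurableT_comp => //;
      exact: measurable_funB.
  - apply/measurable_EFinP; apply: measurableT_comp => //;
      exact: measurable_funB.
  - by apply: filterS GE => x ->.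
exists G; split.
  apply: (SH1_ae_limit hf).
  have : {ae weighted_measure hD pc, forall x,
      L1fun (f k) x @[k --> \oo] --> L1fun G x}.
    by apply: filterS2 fg GE => x h ->; exact: h.
  exact: ae_weighted.
move=> B /nbhs_ballP[e /= e0 GB].
have [k hk] : exists k, ((2^-1) ^+ k.+1 < e / 2 :> R)%R.
  have h1 : (`|2^-1 : R| < 1)%R by rewrite gtr0_norm ?invr_gt0//
    invf_lt1 ?ltr1n.
  have [k _ hk] := cvgr_lt _ (cvg_expr h1) _ (divr_gt0 e0 (ltr0Sn R 1)).
  by exists k; exact: (hk k.+1 (leqnSn k)).
apply: filterS (FA k) => h Ah; apply: GB; rewrite ballEmdist /=.
apply: le_lt_trans (metric_triangle G (f k) h) _.
rewrite [e]splitr metric_sym; apply: ler_ltD.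
  by rewrite (le_trans (dfG k))// ltW.
apply: le_lt_trans hk; apply: hA => //; exact: Af.
Qed.

End SH1_theory.

Theorem theorem3p2 (R : realType) (n : nat) (hn : (0 < n)%N)
    (D : set 'rV[R]_n) (hD : domain D)
    (phi : 'rV[R]_n -> R) (hphi : norming D phi) :
  compact (SH1 hD (norming_positive_continuous hphi)).
Proof. by case: n hn D hD phi hphi => [//|n] _ D hD phi hphi;
  exact: SH1_compact. Qed.
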